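(* Let $m\ge2$, $n\ge 0$, $0\le k\le n$, let $\rho=|\vec n_0\rangle\langle\vec n_0|$ with $\vec n_0\in\mathcal H_n^m$ a Fock state, and $N_0=N(\vec n_0)$. For $g\in\mathrm{SU}(m)$ and an outcome $\vec n\in\mathbb N^m$ with $|\vec n|=n$, the PNR filter function is $$f_{\lambda_k}(\vec n,g)=\frac{1}{s_{\lambda_k}}\,\frac{(-1)^{\varphi(N_0)}}{\vec n!}\sum_{M\in\mathrm{GT}(\lambda_k)}C^{M}_{N_0,\bar N_0}\sum_{N'\in\mathrm{GT}(\tau_n^m)}\frac{(-1)^{\varphi(N')}}{\vec n'!}\,C^{M}_{N',\bar N'}\,\big|\mathrm{per}(g_{\vec n,\vec n'})\big|^2 ,$$ where $\vec n'$ is the Fock occupation vector with $N'=N(\vec n')$, $s_{\lambda_k}=\frac{m-1}{2k+m-1}\binom{k+m-2}{k}^{-1}$, and only terms with $M$ of zero weight contribute.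
   Context: Fix integers $m\ge 2$, $n\ge0$. $\mathcal H_n^m$ is the span of Fock states $|\vec n\rangle=|n_1,\dots,n_m\rangle$, $\vec n\in\mathbb N^m$, $\sum_in_i=n$. $\tau_n^m$ is the totally symmetric irrep of $\mathrm{SU}(m)$ on $\mathcal H_n^m$ given by passive transformations; $\bar\tau_n^m$ its complex conjugate in the Fock basis; $\omega_n^m(g)(X)=\tau_n^m(g)X\tau_n^m(g)^\dagger\cong\tau_n^m\otimes\bar\tau_n^m$ via vectorization $|A\rangle\!\rangle=\sum\langle\vec n|A|\vec m\rangle|\vec n\rangle\otimes|\vec m\rangle$. $\lambda_k$ is the irrep with Young diagram $(2k,k,\dots,k,0)$ (first row $2k$ boxes, rows $2,\dots,m-1$ with $k$ boxes, empty last row), $d_{\lambda_k}$ its dimension; $\tau_n^m\otimes\bar\tau_n^m\cong\bigoplus_{k=0}^n\lambda_k$ multiplicity-free, and $P_{\lambda_k}$ is the orthogonal projector onto the $\lambda_k$ component. Gelfand–Tsetlin (GT) patterns: for an irrep $\lambda=(\lambda_1,\dots,\lambda_m)$, $\lambda_m=0$, a GT pattern $M=(M_{i,j})_{1\le i\le j\le m}$ has $M_{i,m}=\lambda_i$ and $M_{i,j+1}\ge M_{i,j}\ge M_{i+1,j+1}$; $\mathrm{GT}(\lambda)$ is the set of such patterns and $\{|M\rangle\}$ the orthonormal GT basis of $\lambda$ (Condon–Shortley convention). The Fock state $|\vec n\rangle$ is identified with the GT basis vector $|N\rangle$ of $\tau_n^m$ with $N_{1,j}=n_1+\dots+n_j$,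 $N_{i,j}=0$ for $i\ge2$; write $N=N(\vec n)$. The dual pattern of $M$ is $\bar M_{i,l}:=M_{1,m}-M_{l-i+1,l}$, a GT basis label of the dual irrep. With $s_M(k)=\sum_{j=1}^k\sum_{i=1}^jM_{i,j}$ and $M_{\max}$ the highest-weight pattern ($M_{i,j}=M_{i,m}$), set $\varphi(M):=s_M(m-1)-s_{M_{\max}}(m-1)\in\mathbb Z$; then, regarding the Fock basis vector as a basis vector of $\bar\tau_n^m$, $|N\rangle=(-1)^{\varphi(N)}|\bar N\rangle$. For $N_1,N_2\in\mathrm{GT}(\tau_n^m)$ and $M\in\mathrm{GT}(\lambda_k)$, the real SU($m$) Clebsch–Gordan coefficients are $C^M_{N_1,\bar N_2}:=\langle N_1,\bar N_2|M\rangle$, i.e. $|N_1\rangle\otimes|\bar N_2\rangle=\sum_k\sum_{M\in\mathrm{GT}(\lambda_k)}C^M_{N_1,\bar N_2}|M\rangle$; they vanish unless the weight of $M$ is the sum of the weights of $N_1$ and $\bar N_2$. Filter function: for input $\rho=|\vec n_0\rangle\langle\vec n_0|$, $f_{\lambda}(\vec n,g):=s_{\lambda}^{-1}\langle\vec n|\tau_n^m(g)\,[P_{\lambda}(\rho)]\,\tau_n^m(g)^\dagger|\vec n\rangle$, with $s_\lambda:=d_\lambda^{-1}\sum_{\vec n\in\mathbb N^m}\langle\!\langle\vec n,\vec n|P_\lambda|\vec n,\vec n\rangle\!\rangle$. Multi-index factorial $\vec n!:=n_1!\cdots n_m!$. For an $m\times m$ matrix $g$, $g_{\vec n,\vec n'}$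 is the $n\times n$ matrix obtained by taking $n'_j$ copies of the $j$-th column of $g$ and then $n_i$ copies of the $i$-th row of the result; $\mathrm{per}(A)=\sum_{\pi\in S_n}\prod_{i}A_{i,\pi(i)}$. *)

(* Defs.v *)
From HB Require Import structures.
From mathcomp Require Import all_boot all_order all_algebra all_fingroup.
From mathcomp Require Import reals.
From mathcomp.real_closed Require Import complex.

Set Implicit Arguments.
Unset Strict Implicit.
Unset Printing Implicit Defensive.

Import Order.TTheory GRing.Theory Num.Theory.
Local Open Scope ring_scope.

(* MathComp (+ mathcomp-analysis `reals` for realType, and
   mathcomp-real-closed `complex` for the complex numbers R[i]). *)

Section Defs.
Variable R : realType.
Local Notation C := R[i].
Variables m n : nat.

(* ---------- Fock states of H_n^m ---------- *)
Definition fock := {f : {ffun 'I_m -> 'I_n.+1} | \sum_(i < m) (f i : nat) == n}.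
Definition occ (v : fock) (i : 'I_m) : nat := sval v i.
(* multi-index factorial  n! = n_1! ... n_m! *)
Definition mfact (v : fock) : nat := \prod_(i < m) (occ v i)`!.

(* ---------- Passive transformation tau_n^m(g) ---------- *)
(* First-quantised picture: H_n^m is the symmetric subspace of (C^m)^{(x)n},
   the Fock state |v> being the normalised symmetrisation
   sqrt(v!/n!) * sum_{words a of type v} e_{a_1} (x) ... (x) e_{a_n},
   and tau(g) is the restriction of g^{(x)n}. *)
Definition word := {ffun 'I_n -> 'I_m}.
Definition of_type (a : word) (v : fock) : bool :=
  [forall i, #|[pred l | a l == i]| == occ v i].
Definition tau_el (g : 'M[C]_m) (v w : fock) : C :=
  ((Num.sqrt (((mfact v * mfact w)%:R : R) / ((n`! ^ 2)%:R)))%:C%C)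
  * \sum_(a : word | of_type a v) \sum_(b : word | of_type b w)
      \prod_(l < n) g (a l) (b l).

(* operators on H_n^m, as matrices indexed by Fock states *)
Definition Op := {ffun fock * fock -> C}.
Definition tau (g : 'M[C]_m) : Op := [ffun p => tau_el g p.1 p.2].
Definition opmul (A B : Op) : Op := [ffun p => \sum_(z : fock) A (p.1, z) * B (z, p.2)].
Definition adj (A : Op) : Op := [ffun p => (A (p.2, p.1))^*].
(* omega_n^m(g)(X) = tau(g) X tau(g)^dagger *)
Definition omega (g : 'M[C]_m) (X : Op) : Op := opmul (opmul (tau g) X) (adj (tau g)).
(* the holomorphic extension X |-> tau(g) X tau(g^{-1}) (used for highest weights) *)
Definition omegaGL (g : 'M[C]_m) (X : Op) : Op := opmul (opmul (tau g) X) (tau (invmx g)).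
(* Hilbert-Schmidt inner product <<A|B>> *)
Definition hs (A B : Op) : C := \sum_(p : fock * fock) (A p)^* * B p.
(* |v><w| *)
Definition ketbra (v w : fock) : Op := [ffun p => ((p.1 == v) && (p.2 == w))%:R].

Definition is_SU (g : 'M[C]_m) : Prop :=
  g *m (map_mx (fun x : C => x^*) g)^T = 1%:M /\ \det g = 1.
Definition upper_unitri (u : 'M[C]_m) : Prop :=
  forall i j : 'I_m, ((j < i)%N -> u i j = 0) /\ (i = j -> u i j = 1).

(* ---------- the lambda_k component of omega = tau (x) taubar ---------- *)
(* X is a weight vector of (torus) weight mu: only |x><y| with x - y = mu occur *)
Definition is_weight (X : Op) (mu : 'I_m -> int) : Prop :=
  forall x y : fock, X (x, y) != 0 -> forall i, (occ x i)%:Z - (occ y i)%:Z = mu i.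
(* highest weight of lambda_k = (2k,k,...,k,0), shifted by -k(1,...,1) *)
Definition hw_weight (k : nat) (i : 'I_m) : int :=
  if val i == 0%N then k%:Z else if val i == m.-1 then - k%:Z else 0.
(* highest-weight vectors of weight lambda_k (fixed by the upper unitriangular group) *)
Definition HW (k : nat) (X : Op) : Prop :=
  is_weight X (hw_weight k) /\ forall u, upper_unitri u -> omegaGL u X = X.
(* the lambda_k component: the SU(m)-invariant subspace generated by them *)
Definition Vcomp (k : nat) (X : Op) : Prop :=
  exists s : seq ('M[C]_m * Op),
    (forall p, p \in s -> is_SU p.1 /\ HW k p.2) /\
    X = \sum_(p <- s) omega p.1 p.2.

(* P is the orthogonal projector (w.r.t. the HS inner product) onto V *)
Definition is_orth_proj (V : Op -> Prop) (P : Op -> Op) : Prop :=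
  forall X, V (P X) /\ forall Y, V Y -> hs Y (X - P X) = 0.

(* dimension *)
Definition lin_indep (s : seq Op) : Prop :=
  forall c : 'I_(size s) -> C, \sum_(i < size s) c i *: s`_i = 0 -> forall i, c i = 0.
Definition in_span (s : seq Op) (X : Op) : Prop :=
  exists c : 'I_(size s) -> C, X = \sum_(i < size s) c i *: s`_i.
Definition is_dim (V : Op -> Prop) (d : nat) : Prop :=
  exists s : seq Op, [/\ size s = d, forall X, X \in s -> V X, lin_indep s &
                         forall X, V X -> in_span s X].

(* s_lambda = d_lambda^{-1} sum_v <<v,v| P |v,v>> *)
Definition s_lambda (d : nat) (P : Op -> Op) : C :=
  (d%:R)^-1 * \sum_(v : fock) P (ketbra v v) (v, v).
(* filter function f_lambda(v, g) for input rho = |v0><v0| *)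
Definition filter_fn (s : C) (P : Op -> Op) (v0 v : fock) (g : 'M[C]_m) : C :=
  s^-1 * omega g (P (ketbra v0 v0)) (v, v).

(* ---------- permanents and g_{v,w} ---------- *)
Definition per (p : nat) (A : 'M[C]_p) : C :=
  \sum_(s : 'S_p) \prod_(i < p) A i (s i).
(* the sequence in which index i is repeated occ v i times *)
Definition rep_seq (v : fock) : seq 'I_m := flatten [seq nseq (occ v i) i | i <- enum 'I_m].
Definition gsub (g : 'M[C]_m) (v w : fock) : 'M[C]_n :=
  \matrix_(r < n, c < n)
    match onth (rep_seq v) r, onth (rep_seq w) c with
    | Some i, Some j => g i j
    | _, _ => 0
    end.

(* ---------- Gelfand-Tsetlin patterns ---------- *)
(* 0-based: M (i,j) for i <= j < m; entries with i > j are set to 0;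
   the top row M(i, m-1) is lam i; betweenness M(i,j+1) >= M(i,j) >= M(i+1,j+1). *)
Definition isGT (lam : 'I_m -> nat) (B : nat) (M : {ffun 'I_m * 'I_m -> 'I_B.+1}) : bool :=
  [&& [forall i : 'I_m, forall j : 'I_m, (j < i)%N ==> (val (M (i, j)) == 0%N)],
      [forall i : 'I_m, forall j : 'I_m, (val j == m.-1) ==> (val (M (i, j)) == lam i)],
      [forall i : 'I_m, forall j : 'I_m, forall j' : 'I_m, ((val j' == (val j).+1) && (i <= j)%N)
                 ==> (val (M (i, j)) <= val (M (i, j')))%N] &
      [forall i : 'I_m, forall i' : 'I_m, forall j : 'I_m, forall j' : 'I_m,
          [&& val i' == (val i).+1, val j' == (val j).+1 & (i <= j)%N]
                 ==> (val (M (i', j')) <= val (M (i, j)))%N]].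
Definition GTpat (lam : 'I_m -> nat) :=
  {M : {ffun 'I_m * 'I_m -> 'I_(\max_(i < m) lam i).+1} | isGT lam M}.
Definition Mv (lam : 'I_m -> nat) (M : GTpat lam) (i j : 'I_m) : nat := val (sval M (i, j)).

(* lambda_k = (2k, k, ..., k, 0) *)
Definition lam (k : nat) (i : 'I_m) : nat :=
  if val i == 0%N then k.*2 else if val i == m.-1 then 0%N else k.
(* weight of a GT pattern: row sums of level j minus level j-1 *)
Definition wt (lm : 'I_m -> nat) (M : GTpat lm) (j : 'I_m) : int :=
  (\sum_(i < m | (i <= j)%N) Mv M i j)%:Z
  - (\sum_(j' < m | (j'.+1 == j)%N) \sum_(i < m | (i <= j')%N) Mv M i j')%:Z.

(* GT pattern N(v) of a Fock state and the phase phi *)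
Definition fockGT (v : fock) (i j : 'I_m) : nat :=
  if val i == 0%N then \sum_(l < m | (l <= j)%N) occ v l else 0%N.
(* highest weight (n,0,...,0) of tau_n^m *)
Definition lamtau (i : 'I_m) : nat := if val i == 0%N then n else 0%N.
(* s_M(K) = sum_{j=1}^K sum_{i=1}^j M_{i,j} (1-based) *)
Definition sM (f : 'I_m -> 'I_m -> nat) (K : nat) : nat :=
  \sum_(j < m | (j < K)%N) \sum_(i < m | (i <= j)%N) f i j.
(* phi(N) = s_N(m-1) - s_{N_max}(m-1), N_max(i,j) = top row entry lambda_i *)
Definition phi (lm : 'I_m -> nat) (f : 'I_m -> 'I_m -> nat) : int :=
  (sM f m.-1)%:Z - (sM (fun i _ => lm i) m.-1)%:Z.
Definition phiF (v : fock) : int := phi lamtau (fockGT v).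

(* Real Clebsch-Gordan coefficients C^M_{N(v), bar N(w)} = <N(v), bar N(w) | M>,
   where b M in End(H) ~ H (x) H (vectorisation) is the basis vector |M>, and
   |bar N(w)> = (-1)^phi(N(w)) |w> (the Fock vector regarded in taubar). *)
Definition CG (lm : 'I_m -> nat) (b : GTpat lm -> Op) (M : GTpat lm) (v w : fock) : C :=
  (-1) ^ (phiF w) * b M (v, w).

(* b is an orthonormal basis family of the lambda_k component, indexed by GT(lambda_k),
   with real CG coefficients, each |M> a weight vector of the SU(m)-weight of M. *)
Definition GT_basis (k : nat) (b : GTpat (lam k) -> Op) : Prop :=
  [/\ forall M, Vcomp k (b M),
      forall M M', hs (b M) (b M') = (M == M')%:R,
      forall M p, b M p \is Num.real &
      forall M x y, b M (x, y) != 0 ->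
        forall i, (occ x i)%:Z - (occ y i)%:Z = wt M i - k%:Z].

End Defs.

(* Main.v *)
Require Import Defs.
From HB Require Import structures.
From mathcomp Require Import all_boot all_order all_algebra all_fingroup.
From mathcomp Require Import reals ring zify.
From mathcomp.real_closed Require Import complex.

Set Implicit Arguments.
Unset Strict Implicit.
Unset Printing Implicit Defensive.

Import Order.TTheory GRing.Theory Num.Theory.
Local Open Scope ring_scope.

(** The highest-weight vector of lambda_k in End(H) is unique up to a scalar:
    it is the compression to the symmetric subspace of
    E_{1m}^{(x)k} (x) 1^{(x)(n-k)}.  Its translates under g in SU(m) therefore
    depend on g only through the monomials u^alpha w^beta of bidegree (k,k),
    where u and conj(w) are the first and last columns of g.  Since u.w = 0,
    the coefficient array (alpha,beta) |-> u^alpha w^beta is traceless, and a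
    traceless array is determined by its entries with alpha_1 = 0 or
    beta_1 = 0.  The number of those pairs bounds the dimension of the lambda_k
    component from above, and they inject into GT(lambda_k) by
    M_{i,j} = k + [i=1](alpha_1+...+alpha_j) - [i=j](beta_1+...+beta_j),
    whose weight is k + alpha - beta.  Hence the given orthonormal family
    indexed by GT(lambda_k) is a basis of the component, which gives the
    projector, the dimension, and s_lambda as a quotient of two counts.  The
    permanents come from writing tau(g) as the compression of g^{(x)n}; the
    factorials count the permutations stabilising a word. *)

(** * Words and Fock states *)

Section Fibers.
Variables (T I : finType) (a : T -> I).

Definition fiber (i : I) : {set T} := [set l | a l == i].

(** The list [r] of colours whose fibres may be permuted internally serves the induction: an empty
    list leaves only the identity, and a list of all colours gives the full stabiliser of [a]. *)
Definition fiber_stab (r : seq I) : {set {perm T}} :=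
  [set s : {perm T} | [forall l, a (s l) == a l]
     && [forall l, (a l \notin r) ==> (s l == l)]].

Lemma fiber_stabP (r : seq I) (s : {perm T}) :
  reflect ((forall l, a (s l) = a l) /\ (forall l, a l \notin r -> s l = l))
    (s \in fiber_stab r).
Proof.
rewrite inE; apply: (iffP andP) => -[h1 h2]; split.
- by move=> l; apply/eqP/(forallP h1).
- by move=> l hl; apply/eqP; move/forallP: h2 => /(_ l); rewrite hl.
- by apply/forallP => l; rewrite h1.
- by apply/forallP => l; apply/implyP => hl; rewrite h2.
Qed.

(** A new colour [i] multiplies the group by the symmetric group of the fibre over [i]. The two
    factors have disjoint supports, so the product map is a bijection onto the larger stabiliser. *)
Lemma card_fiber_stab_seq (r : seq I) : uniq r ->
  #|fiber_stab r| = (\prod_(i <- r) #|fiber i|`!)%N.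
Proof.
elim: r => [_|i r IH /= /andP[ir ur]].
  rewrite big_nil; apply/eqP/cards1P; exists 1%g; apply/setP => s.
  rewrite in_set1; apply/fiber_stabP/eqP => [[_ h]|->].
    by apply/permP => l; rewrite h // perm1.
  by split=> l; rewrite perm1.
rewrite big_cons -IH // -(card_Sym (fiber i)) -cardsX.
have onF (s : {perm T}) l : perm_on (fiber i) s -> (a (s l) == i) = (a l == i).
  by move=> hs; have := perm_closed l hs; rewrite !inE.
have stF (s : {perm T}) l : perm_on (fiber i) s -> a l != i -> s l = l.
  by move=> hs hl; apply: (out_perm hs); rewrite inE.
rewrite -(card_in_imset (f := fun p : {perm T} * {perm T} => (p.1 * p.2)%g));
    last first.
  move=> [s t] [s' t'] /setXP[/=]; rewrite inE => hs /fiber_stabP[_ ht].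
  move=> /setXP[/=]; rewrite inE => hs' /fiber_stabP[_ ht'] /permP e.
  have ess' : s = s'.
    apply/permP => l; have [hl|hl] := boolP (a l == i); last by rewrite !stF.
    have := e l; rewrite !permM ht ?ht' //.
      by move: (onF s' l hs'); rewrite hl => /eqP ->.
    by move: (onF s l hs); rewrite hl => /eqP ->.
  subst s'; congr (_, _); apply/permP => l.
  by have := e (s^-1%g l); rewrite !permM permKV.
apply: eq_card => s; apply/fiber_stabP/imsetP; last first.
  move=> [[s1 s2] /setXP[/=]]; rewrite inE => h1 /fiber_stabP[h2 h3] ->.
  have h1a l : a (s1 l) = a l.
    have [hl|hl] := boolP (a l == i); last by rewrite stF.
    by move: (onF s1 l h1); rewrite hl => /eqP ->; apply/esym/eqP.
  split=> l; first by rewrite permM h2.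
  by rewrite in_cons negb_or => /andP[li lr]; rewrite permM (stF _ _ h1) // h3.
move=> [h1 h2].
have sN : s \in 'N(fiber i | 'P)%g.
  rewrite /astabs !inE /=; apply/subsetP => l; rewrite !inE.
  by rewrite /= /aperm h1.
set t := restr_perm (fiber i) s.
have tF : perm_on (fiber i) t by apply: restr_perm_on.
have tVF : perm_on (fiber i) t^-1%g by apply: perm_onV.
have te l : a l = i -> t l = s l by move=> hl; rewrite restr_permE // inE hl.
(* The factorisation of [s]: its restriction to the fibre, followed by what remains. *)
exists (t, t^-1 * s)%g; last by rewrite /= mulKVg.
apply/setXP; split; first by rewrite /= inE.
have fixF l : a l = i -> s (t^-1%g l) = l.
  move=> hl; rewrite -te ?permKV //.
  by apply/eqP; rewrite (onF _ _ tVF) hl.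
apply/fiber_stabP; split=> l; rewrite permM.
  have [/eqP hl|hl] := boolP (a l == i); first by rewrite fixF.
  by rewrite (stF _ _ tVF).
move=> hr; have [/eqP hl|hl] := boolP (a l == i); first by rewrite fixF.
by rewrite (stF _ _ tVF) // h2 // in_cons negb_or hl.
Qed.

Lemma card_fiber_stab :
  #|[set s : {perm T} | [forall l, a (s l) == a l]]| = (\prod_i #|fiber i|`!)%N.
Proof.
rewrite -(card_fiber_stab_seq (index_enum_uniq I)).
apply: eq_card => s; rewrite !inE; apply: esym.
rewrite [X in _ && X](_ : _ = true) ?andbT //.
by apply/forallP => l; rewrite mem_index_enum.
Qed.

End Fibers.

Section FockWords.
Variables (m n : nat).
Implicit Types (v w : fock m n) (a b : word m n).

Lemma occ_inj v w : (forall i, occ v i = occ w i) -> v = w.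
Proof. by move=> h; apply/val_inj/ffunP => i; apply/val_inj/h. Qed.

Lemma sum_occ v : (\sum_i occ v i)%N = n.
Proof. by apply/eqP; exact: (valP v). Qed.

Lemma fock_exists (f : 'I_m -> nat) : (\sum_i f i)%N = n ->
  exists v : fock m n, forall i, occ v i = f i.
Proof.
move=> hf; have le i : (f i < n.+1)%N by rewrite ltnS -hf (bigD1 i) //= leq_addr.
pose F : {ffun 'I_m -> 'I_n.+1} := [ffun i => Ordinal (le i)].
have e : (\sum_(i < m) (F i : nat) == n)%N.
  by apply/eqP; rewrite -[RHS]hf; apply: eq_bigr => i _; rewrite ffunE.
by exists (exist _ F e) => i; rewrite /occ /= ffunE.
Qed.

Lemma sum_card_fiber (A : {set 'I_n}) (a : 'I_n -> 'I_m) :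
  (\sum_i #|[set l in A | a l == i]|)%N = #|A|.
Proof.
rewrite -sum1_card (partition_big a xpredT) //=; apply: eq_bigr => i _.
by rewrite -sum1_card; apply: eq_bigl => l; rewrite inE.
Qed.

Lemma type_exists a : exists v, of_type a v.
Proof.
have [|v hv] := @fock_exists (fun i => #|[pred l | a l == i]|).
  have := sum_card_fiber setT a; rewrite cardsT card_ord => e.
  rewrite -[RHS]e; apply: eq_bigr => i _.
  by apply: eq_card => l; rewrite !inE.
by exists v; apply/forallP => i; rewrite hv.
Qed.

Definition word_type a : fock m n := xchoose (type_exists a).

Lemma occ_word_type a i : occ (word_type a) i = #|fiber a i|.
Proof.
by move/forallP: (xchooseP (type_exists a)) => /(_ i) /eqP <-;
   apply: eq_card => l; rewrite !inE.
Qed.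

Lemma of_typeE a v : of_type a v = (word_type a == v).
Proof.
apply/idP/eqP => [/forallP h|<-]; last exact: xchooseP.
apply: occ_inj => i; rewrite occ_word_type -(eqP (h i)).
by apply: eq_card => l; rewrite !inE.
Qed.

Definition wperm (s : 'S_n) a : word m n := [ffun l => a (s l)].

Lemma wpermK (s : 'S_n) : cancel (wperm s) (wperm s^-1%g).
Proof. by move=> a; apply/ffunP => l; rewrite !ffunE permKV. Qed.

Lemma wpermVK (s : 'S_n) : cancel (wperm s^-1%g) (wperm s).
Proof. by move=> a; apply/ffunP => l; rewrite !ffunE permK. Qed.

Lemma wperm_bij s : bijective (wperm s).
Proof. by exists (wperm s^-1%g); [apply: wpermK|apply: wpermVK]. Qed.

Lemma word_type_perm s a : word_type (wperm s a) = word_type a.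
Proof.
apply: occ_inj => i; rewrite !occ_word_type.
rewrite -(card_imset (fiber (wperm s a) i) (@perm_inj _ s)).
apply: eq_card => l; rewrite inE; apply/imsetP/eqP => [[l' + ->]|hl].
  by rewrite inE ffunE => /eqP.
by exists (s^-1%g l); rewrite ?permKV // inE ffunE permKV hl.
Qed.

Lemma rep_seq_size v : size (rep_seq v) = n.
Proof.
rewrite /rep_seq size_flatten /shape -map_comp sumnE big_map.
rewrite -[RHS](sum_occ v) big_enum /=.
by apply: eq_bigr => i _; rewrite size_nseq.
Qed.

(** The sorted word of type [v]; its letters label the rows and columns of [gsub]. *)
Definition rep_word v : word m n :=
  [ffun l => tnth (Tuple (introT eqP (rep_seq_size v))) l].

Lemma onth_rep_seq v (l : 'I_n) : onth (rep_seq v) l = Some (rep_word v l).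
Proof.
by rewrite ffunE (tnth_nth (rep_word v l)) /= onthE (nth_map (rep_word v l))
  ?rep_seq_size.
Qed.

Lemma word_type_rep v : word_type (rep_word v) = v.
Proof.
apply: occ_inj => i; rewrite occ_word_type.
have e : rep_seq v = [seq rep_word v l | l <- enum 'I_n].
  apply: (@eq_from_nth _ i) => [|l].
    by rewrite (size_map _ (enum 'I_n)) size_enum_ord rep_seq_size.
  rewrite rep_seq_size => ln; rewrite (nth_map (Ordinal ln)) ?size_enum_ord //.
  by rewrite (nth_ord_enum (Ordinal ln) (Ordinal ln)) ffunE (tnth_nth i).
have -> : #|fiber (rep_word v) i| = count_mem i (rep_seq v).
  rewrite e count_map enumT cardE /enum_mem size_filter.
  by apply: eq_count => l; rewrite /= inE.
rewrite /rep_seq count_flatten -map_comp sumnE big_map big_enum /= (bigD1 i) //=.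
rewrite count_nseq /= eqxx mul1n big1 ?addn0 // => j ji.
by rewrite count_nseq /= (negbTE ji).
Qed.

(** Words of equal type form one orbit under permutation of the slots. The permutations carrying [a]
    to [b] then form a coset of the stabiliser of [a], whose order is a product of factorials of
    fibre sizes. *)
Lemma card_wperm_fiber (a b : word m n) :
  #|[set s : 'S_n | wperm s a == b]|
  = ((word_type a == word_type b) * mfact (word_type a))%N.
Proof.
have [e|ne] := eqVneq; last first.
  apply/eqP; rewrite mul0n cards_eq0; apply/eqP/setP => s; rewrite !inE.
  by apply: contraNF ne => /eqP <-; rewrite word_type_perm.
rewrite mul1n.
have stabE : #|[set s : 'S_n | wperm s a == a]| = mfact (word_type a).
  rewrite /mfact (eq_bigr (fun i => #|fiber a i|`!)%N) => [|i _]; last first.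
    by rewrite occ_word_type.
  rewrite -card_fiber_stab; apply: eq_card => s; rewrite !inE.
  apply/eqP/forallP => [/ffunP h l|h]; first by rewrite -[in X in _ == X]h ffunE.
  by apply/ffunP => l; rewrite ffunE; apply/eqP.
have [s0 hs0] : exists s0 : 'S_n, wperm s0 a = b.
  pose tu (c : word m n) := [tuple c l | l < n].
  have : perm_eq (tu b) (tu a).
    apply/allP => i _ /=; apply/eqP.
    have h (c : word m n) : count_mem i (tu c) = #|fiber c i|.
      rewrite /= count_map enumT cardE /enum_mem size_filter.
      by apply: eq_count => l; rewrite /= inE.
    by rewrite !h -!occ_word_type e.
  move=> /tuple_permP[s hs]; exists s; apply/ffunP => l.
  rewrite ffunE -(tnth_mktuple b l) -[RHS]/(tnth (tu b) l).
  have -> : tu b = [tuple tnth (tu a) (s i) | i < n] by apply: val_inj.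
  by rewrite !tnth_mktuple.
rewrite -stabE -[RHS](card_imset _ (mulgI s0)); apply: eq_card => s; rewrite [LHS]inE.
apply/eqP/imsetP => [hs|[t + ->]].
  exists (s0^-1 * s)%g; last by rewrite mulKVg.
  rewrite inE; apply/eqP/ffunP => l; rewrite ffunE permM.
  move/ffunP: hs => /(_ (s0^-1 l)%g); rewrite ffunE => ->.
  by rewrite -hs0 ffunE permKV.
rewrite inE => /eqP /ffunP h; rewrite -hs0; apply/ffunP => l.
by rewrite !ffunE permM -[RHS]h ffunE.
Qed.

(** Sorting the [n!] permutations by the image of [rep_word v] hits each word of type [v] exactly
    [mfact v] times. *)
Lemma card_words_of_type v : (mfact v * #|[set a | word_type a == v]| = n`!)%N.
Proof.
rewrite -[RHS](card_Sn n) -[RHS]sum1_card.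
rewrite [RHS](partition_big (fun s => wperm s (rep_word v)) xpredT) //=.
rewrite -sum1_card big_distrr /= [RHS](bigID (fun a => word_type a == v)) /=.
rewrite [X in (_ + X)%N]big1 ?addn0 => [|a ne].
  under eq_bigl => a do rewrite inE.
  apply: eq_bigr => a /eqP ea; rewrite muln1 sum1dep_card.
  by rewrite card_wperm_fiber word_type_rep ea eqxx mul1n.
rewrite sum1dep_card card_wperm_fiber word_type_rep.
by rewrite eq_sym (negbTE ne).
Qed.
End FockWords.

(** * Compression to the symmetric subspace *)

Section Compression.
Variables (R : realType) (m n : nat).
Local Notation C := R[i].
Implicit Types (v w x y : fock m n) (a b : word m n) (g h : 'M[C]_m).

Lemma eq_word_type a b : word_type a = word_type b ->
  exists s, wperm s a = b.
Proof.
move=> e; have: (0 < #|[set s : 'S_n | wperm s a == b]|)%N.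
  by rewrite card_wperm_fiber e eqxx mul1n prodn_gt0 // => i; apply: fact_gt0.
by case/card_gt0P => s; rewrite inE => /eqP; exists s.
Qed.

(** The coefficient of each word in the normalised symmetrisation that represents |v>; by [amp_card]
    its square is the inverse of the number of words of type [v]. *)
Definition amp v : C := (Num.sqrt ((mfact v)%:R / n`!%:R : R))%:C%C.

Lemma mfact_neq0 v : (mfact v)%:R != 0 :> C.
Proof. by rewrite pnatr_eq0 -lt0n prodn_gt0 // => i; apply: fact_gt0. Qed.

Lemma fact_neq0 : n`!%:R != 0 :> C.
Proof. by rewrite pnatr_eq0 -lt0n fact_gt0. Qed.

Lemma amp_sqr v : amp v ^+ 2 = (mfact v)%:R / n`!%:R.
Proof.
rewrite /amp -rmorphXn /= sqr_sqrtr; last by rewrite divr_ge0.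
by rewrite rmorphM /= fmorphV /= !rmorph_nat.
Qed.

Lemma amp_neq0 v : amp v != 0.
Proof.
rewrite -sqrf_eq0 amp_sqr mulf_neq0 ?mfact_neq0 //.
by rewrite invr_eq0 fact_neq0.
Qed.

Lemma conj_amp v : (amp v)^* = amp v.
Proof. by rewrite conj_Creal // complex_real. Qed.

Lemma amp_card v : amp v ^+ 2 * #|[set a | word_type a == v]|%:R = 1.
Proof.
rewrite amp_sqr mulrAC -natrM card_words_of_type mulfV //; exact: fact_neq0.
Qed.

(** The Fock-basis matrix of the compression to the symmetric subspace of the operator on the n-fold
    tensor power of C^m whose matrix in the word basis is [Y]. *)
Definition compress (Y : word m n -> word m n -> C) : Op R m n :=
  [ffun p => amp p.1 * amp p.2 *
     \sum_(a | word_type a == p.1) \sum_(b | word_type b == p.2) Y a b].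

Definition perm_invariant (Y : word m n -> word m n -> C) : Prop :=
  forall s a b, Y (wperm s a) (wperm s b) = Y a b.

Lemma eq_compress (Y Z : word m n -> word m n -> C) :
  (forall a b, Y a b = Z a b) -> compress Y = compress Z.
Proof.
move=> e; apply/ffunP => p; rewrite !ffunE; congr (_ * _).
by apply: eq_bigr => a _; apply: eq_bigr => b _.
Qed.

Lemma sum_word_perm s x (F : word m n -> C) :
  \sum_(a | word_type a == x) F a = \sum_(a | word_type a == x) F (wperm s a).
Proof.
rewrite (reindex (wperm s)) /=; last exact/onW_bij/wperm_bij.
by apply: eq_bigl => a; rewrite word_type_perm.
Qed.

(** The symmetriser acts trivially on an invariant [f], so an intermediate sum over Fock states
    becomes a sum over words. This makes compression multiplicative as soon as one factor commutes
    with permutations. *)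
Lemma class_sum_const (f h : word m n -> C) :
  (forall s a, f (wperm s a) = f a) ->
  \sum_(z : fock m n) amp z ^+ 2 *
     ((\sum_(b | word_type b == z) f b) * (\sum_(c | word_type c == z) h c))
  = \sum_c f c * h c.
Proof.
move=> hf; rewrite [RHS](partition_big (@word_type m n) xpredT) //=.
apply: eq_bigr => z _.
rewrite mulr_sumr mulr_sumr; apply: eq_bigr => c /eqP hc.
rewrite (eq_bigr (fun=> f c)) => [|b /eqP hb]; last first.
  have [s <-] : exists s, wperm s c = b by apply: eq_word_type; rewrite hb.
  by rewrite hf.
rewrite sumr_const -mulr_natl !mulrA.
have -> : #|[pred b | word_type b == z]| = #|[set b | word_type b == z]|.
  by rewrite cardsE.
by rewrite amp_card mul1r.
Qed.

Definition wmul (Y Z : word m n -> word m n -> C) a b := \sum_c Y a c * Z c b.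

Lemma compress_mull (G Y : word m n -> word m n -> C) : perm_invariant G ->
  opmul (compress G) (compress Y) = compress (wmul G Y).
Proof.
move=> hG; apply/ffunP => -[x y]; rewrite !ffunE /=.
pose f b := \sum_(a | word_type a == x) G a b.
pose h c := \sum_(d | word_type d == y) Y c d.
transitivity (amp x * amp y * \sum_c f c * h c); last first.
  congr (_ * _); rewrite /wmul.
  under [RHS]eq_bigr do rewrite exchange_big /=.
  rewrite exchange_big /=; apply: eq_bigr => c _.
  rewrite mulr_suml; apply: eq_bigr => a _.
  by rewrite mulr_sumr.
rewrite -class_sum_const => [|s a]; last first.
  by rewrite /f (sum_word_perm s); apply: eq_bigr => b _; rewrite hG.
rewrite mulr_sumr; apply: eq_bigr => z _; rewrite !ffunE /= exchange_big /=.
by rewrite -/(f _); ring.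
Qed.

Lemma compress_mulr (G Y : word m n -> word m n -> C) : perm_invariant G ->
  opmul (compress Y) (compress G) = compress (wmul Y G).
Proof.
move=> hG; apply/ffunP => -[x y]; rewrite !ffunE /=.
pose f b := \sum_(a | word_type a == y) G b a.
pose h c := \sum_(d | word_type d == x) Y d c.
transitivity (amp x * amp y * \sum_c f c * h c); last first.
  congr (_ * _); rewrite /wmul.
  under [RHS]eq_bigr do rewrite exchange_big /=.
  rewrite exchange_big /=; apply: eq_bigr => c _.
  rewrite mulrC mulr_suml; apply: eq_bigr => a _.
  by rewrite mulr_sumr.
rewrite -class_sum_const => [|s a]; last first.
  by rewrite /f (sum_word_perm s); apply: eq_bigr => b _; rewrite hG.
rewrite mulr_sumr; apply: eq_bigr => z _; rewrite !ffunE /=.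
rewrite [X in _ * X * _]exchange_big /=.
by rewrite -/(f _) -/(h _); ring.
Qed.

(** The word-basis matrix of the tensor product of the matrices [A l]. *)
Definition pointwise (A : 'I_n -> 'M[C]_m) a b := \prod_l A l (a l) (b l).

Lemma wmul_pointwise (A B : 'I_n -> 'M[C]_m) a b :
  wmul (pointwise A) (pointwise B) a b = pointwise (fun l => A l *m B l) a b.
Proof.
rewrite /pointwise; under [RHS]eq_bigr do rewrite mxE.
rewrite bigA_distr_bigA; apply: eq_bigr => c _.
by rewrite -big_split.
Qed.

Lemma pointwise_perm g : perm_invariant (pointwise (fun=> g)).
Proof.
move=> s a b; rewrite /pointwise [RHS](reindex_inj (@perm_inj _ s)) /=.
by apply: eq_bigr => l _; rewrite !ffunE.
Qed.

Lemma tauE g : tau n g = compress (pointwise (fun=> g)).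
Proof.
apply/ffunP => -[v w]; rewrite !ffunE /= /tau_el; congr (_ * _).
  rewrite /amp -rmorphM /= -sqrtrM ?divr_ge0 //.
  by congr (_ (Num.sqrt _))%C; rewrite natrM natrX; field; rewrite pnatr_eq0 -lt0n fact_gt0.
apply: eq_big => [a|a _]; first by rewrite of_typeE.
by apply: eq_bigl => b; rewrite of_typeE.
Qed.

Definition ctr g : 'M[C]_m := (map_mx (fun x : C => x^*) g)^T.

Lemma adj_tau g : adj (tau n g) = tau n (ctr g).
Proof.
rewrite !tauE; apply/ffunP => -[x y]; rewrite !ffunE /= !rmorphM /= !conj_amp.
congr (_ * _); first by rewrite mulrC.
rewrite exchange_big rmorph_sum; apply: eq_bigr => a _.
rewrite rmorph_sum; apply: eq_bigr => b _; rewrite rmorph_prod.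
by apply: eq_bigr => l _; rewrite !mxE.
Qed.

Lemma opmulA (A B D : Op R m n) : opmul (opmul A B) D = opmul A (opmul B D).
Proof.
apply/ffunP => p; rewrite !ffunE /=.
under eq_bigr do rewrite ffunE /= mulr_suml.
rewrite exchange_big; apply: eq_bigr => z _ /=; rewrite ffunE mulr_sumr.
by apply: eq_bigr => t _; rewrite /= mulrA.
Qed.

Lemma tauM g h : opmul (tau n g) (tau n h) = tau n (g *m h).
Proof.
rewrite !tauE compress_mull; last exact: pointwise_perm.
by apply: eq_compress => a b; rewrite wmul_pointwise.
Qed.

Lemma tau1 : tau n (1%:M : 'M[C]_m) = [ffun p => (p.1 == p.2)%:R].
Proof.
rewrite tauE; apply/ffunP => -[x y]; rewrite !ffunE /=.
have e a b : pointwise (fun=> 1%:M) a b = (a == b)%:R.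
  rewrite /pointwise; have [->|ne] := eqVneq a b.
    by rewrite big1 // => l _; rewrite mxE eqxx.
  have [l hl] : exists l, a l != b l.
    apply/existsP; apply: contraR ne; rewrite negb_exists => /forallP h.
    by apply/eqP/ffunP => l; have := h l; rewrite negbK => /eqP.
  by rewrite (bigD1 l) //= mxE (negbTE hl) mul0r.
under eq_bigr => a _. under eq_bigr do rewrite e. over.
have [<-|ne] := eqVneq x y.
  rewrite -expr2 -[RHS](amp_card x); congr (_ * _).
  rewrite -sum1_card natr_sum; apply: eq_big => [a|a ha]; first by rewrite inE.
  rewrite (bigD1 a) //= eqxx big1 ?addr0 // => b /andP[_ ba].
  by rewrite eq_sym (negbTE ba).
rewrite big1 ?mulr0 // => a /eqP ha; rewrite big1 // => b /eqP hb.
by case: eqP => // eab; move: ne; rewrite -ha -hb eab eqxx.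
Qed.

Lemma opmul1 (X : Op R m n) : opmul X (tau n 1%:M) = X.
Proof.
apply/ffunP => -[x y]; rewrite ffunE (bigD1 y) //= tau1 ffunE /= eqxx mulr1.
by rewrite big1 ?addr0 // => z zy; rewrite ffunE /= (negbTE zy) mulr0.
Qed.

Lemma omegaE g X : omega g X = opmul (opmul (tau n g) X) (tau n (ctr g)).
Proof. by rewrite /omega adj_tau. Qed.

Lemma conj_compress g h (A : 'I_n -> 'M[C]_m) :
  opmul (opmul (tau n g) (compress (pointwise A))) (tau n h)
  = compress (pointwise (fun l => g *m A l *m h)).
Proof.
rewrite !tauE compress_mull; last exact: pointwise_perm.
rewrite (eq_compress (@wmul_pointwise _ _)).
rewrite compress_mulr; last exact: pointwise_perm.
by rewrite (eq_compress (@wmul_pointwise _ _)).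
Qed.

(** Permutations are grouped by the permuted column word: each word of type [w] arises from
    [mfact w] of them. *)
Lemma per_gsub g v w :
  per (gsub g v w) = (mfact w)%:R *
    \sum_(b | word_type b == w) pointwise (fun=> g) (rep_word v) b.
Proof.
transitivity (\sum_(s : 'S_n) pointwise (fun=> g) (rep_word v) (wperm s (rep_word w))).
  apply: eq_bigr => s _; rewrite /pointwise; apply: eq_bigr => l _.
  by rewrite mxE !onth_rep_seq; congr (g _ _); rewrite [RHS]ffunE.
rewrite (partition_big (fun s => wperm s (rep_word w)) (fun b => word_type b == w)).
  rewrite mulr_sumr; apply: eq_bigr => b /eqP hb.
  rewrite (eq_bigr (fun=> pointwise (fun=> g) (rep_word v) b)) => [|s /andP[_ /eqP->]] //.
  rewrite sumr_const -[LHS]mulr_natl; congr (_ * _); congr (_%:R).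
  rewrite -[RHS]mul1n -[1%N]/(true : nat) -[in RHS](word_type_rep w).
  have <- : (word_type (rep_word w) == word_type b) = true by rewrite word_type_rep hb eqxx.
  by rewrite -card_wperm_fiber cardsE; apply: eq_card => s.
by move=> s _; rewrite word_type_perm word_type_rep.
Qed.

Lemma tau_per g v w :
  tau_el g v w * (amp v * amp w) = per (gsub g v w) / n`!%:R.
Proof.
have -> : tau_el g v w = tau n g (v, w) by rewrite ffunE.
rewrite tauE ffunE /=.
set F := pointwise _.
(* By permutation invariance all words of type [v] give the same row sum, so the sorted word may
   stand for each of them. *)
rewrite (eq_bigr (fun=> (mfact w)%:R^-1 * per (gsub g v w))) => [|a /eqP ha]; last first.
  rewrite per_gsub mulKf ?mfact_neq0 //.
  have [s <-] : exists s, wperm s (rep_word v) = a.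
    by apply: eq_word_type; rewrite word_type_rep ha.
  rewrite (sum_word_perm s); apply: eq_bigr => b _; exact: pointwise_perm.
rewrite sumr_const.
have -> : #|[pred b | word_type b == v]| = #|[set b | word_type b == v]|.
  by rewrite cardsE.
rewrite -[_ *+ #|_|]mulr_natl.
transitivity ((amp v ^+ 2 * #|[set b | word_type b == v]|%:R) * amp w ^+ 2
   * (mfact w)%:R^-1 * per (gsub g v w)); first by ring.
rewrite amp_card mul1r amp_sqr; field.
by rewrite mfact_neq0 fact_neq0.
Qed.

Lemma tau_norm g v w :
  `|tau_el g v w| ^+ 2 = `|per (gsub g v w)| ^+ 2 / ((mfact v)%:R * (mfact w)%:R).
Proof.
have e : `|amp v * amp w| ^+ 2 = (mfact v)%:R * (mfact w)%:R / n`!%:R ^+ 2.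
  rewrite normCK rmorphM /= !conj_amp.
  transitivity (amp v ^+ 2 * amp w ^+ 2); first by ring.
  by rewrite !amp_sqr; field; exact: fact_neq0.
have h : `|tau_el g v w * (amp v * amp w)| ^+ 2 = `|per (gsub g v w) / n`!%:R| ^+ 2.
  by rewrite tau_per.
rewrite (normrM (tau_el _ _ _)) exprMn e (normrM (per _)) exprMn normfV normr_nat in h.
have h' : `|per (gsub g v w)| ^+ 2 = `|tau_el g v w| ^+ 2 * ((mfact v)%:R * (mfact w)%:R).
  rewrite exprVn in h.
  apply: (mulIf (x := (n`!%:R ^+ 2)^-1)); first by rewrite invr_eq0 expf_neq0 ?fact_neq0.
  by rewrite -[RHS]mulrA h.
by rewrite h' mulfK // mulf_neq0 ?mfact_neq0.
Qed.

End Compression.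

(** * Highest-weight vectors *)

Section HighestWeight.
Variables (R : realType) (m n k : nat).
Local Notation C := R[i].
Hypothesis (kn : (k <= n)%N).
Variables i0 il : 'I_m.
Hypotheses (i0E : val i0 = 0%N) (ilE : val il = m.-1) (i0l : i0 != il).
Implicit Types (v w x y : fock m n) (a b : word m n) (g h : 'M[C]_m).

Lemma compress_gt0 (Y : word m n -> word m n -> C) a0 b0 :
  (forall a b, 0 <= Y a b) -> 0 < Y a0 b0 ->
  compress Y (word_type a0, word_type b0) != 0.
Proof.
move=> h0 h1; rewrite ffunE /= !mulf_neq0 ?amp_neq0 // gt_eqF //.
rewrite (bigD1 a0) //= (bigD1 b0) //= -addrA ltr_wpDr //.
by rewrite addr_ge0 // sumr_ge0 // => a _; rewrite ?sumr_ge0.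
Qed.

Lemma le_last (j : 'I_m) : (j <= il)%N.
Proof.
by rewrite -[nat_of_ord il]/(val il) ilE -ltnS prednK // (leq_ltn_trans _ (ltn_ord j)).
Qed.

Definition hwop (l : 'I_n) : 'M[C]_m :=
  if (l < k)%N then delta_mx i0 il else 1%:M.

Definition hwX : Op R m n := compress (pointwise hwop).

Lemma pointwise_hwop a b : pointwise hwop a b =
  [forall l : 'I_n, if (l < k)%N then (a l == i0) && (b l == il) else a l == b l]%:R.
Proof.
rewrite /pointwise /hwop; case: forallP => [h|/forallP].
  rewrite big1 // => l _; have := h l; case: ifP => _.
    by move=> /andP[/eqP-> /eqP->]; rewrite mxE !eqxx.
  by move=> /eqP->; rewrite mxE eqxx.
rewrite negb_forall => /existsP[l hl]; rewrite (bigD1 l) //=.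
by case: ifP hl => _ hl; rewrite mxE (negbTE hl) mul0r.
Qed.

Lemma pointwise_hwop_ge0 a b : 0 <= pointwise hwop a b.
Proof. by rewrite pointwise_hwop. Qed.

Lemma card_lt_ord : #|[set l : 'I_n | (l < k)%N]| = k.
Proof.
rewrite cardsE -sum1_card -[RHS]card_ord -[RHS]sum1_card.
by rewrite (big_ord_widen n (fun=> 1%N) kn).
Qed.

Lemma hwX_support x y : hwX (x, y) != 0 ->
  exists a b, [/\ word_type a = x, word_type b = y &
    forall l : 'I_n, if (l < k)%N then a l = i0 /\ b l = il else a l = b l].
Proof.
move=> nz.
have [a /andP[/eqP ha]] : exists a, (word_type a == x) && [exists b,
    (word_type b == y) && (pointwise hwop a b != 0)].
  apply/existsP; apply: contraR nz; rewrite negb_exists => /forallP h.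
  rewrite ffunE /= big1 ?mulr0 // => a ha; rewrite big1 // => b hb.
  apply/eqP; move: (h a); rewrite ha /= negb_exists => /forallP /(_ b).
  by rewrite hb /= negbK.
case/existsP => b /andP[/eqP hb]; rewrite pointwise_hwop pnatr_eq0 eqb0 negbK.
move=> /forallP h; exists a, b; split=> // l; have := h l.
by case: ifP => _; [case/andP => /eqP -> /eqP ->|move/eqP].
Qed.

(** Each of the first [k] slots contributes e_1 - e_m to the weight, and every other slot
    contributes nothing. *)
Lemma hwX_weight : is_weight hwX (hw_weight k).
Proof.
move=> x y /hwX_support[a [b [<- <- h]]] i; rewrite !occ_word_type.
have cE (c : word m n) : #|fiber c i|%:Z = \sum_l (c l == i)%:R.
  rewrite -sum1_card -[LHS]natz natr_sum big_mkcond /=; apply: eq_bigr => l _.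
  by rewrite inE; case: eqP.
rewrite !cE -sumrB.
rewrite (eq_bigr (fun l : 'I_n => if (l < k)%N then (i0 == i)%:R - (il == i)%:R else 0 : int));
  last first.
  by move=> l _; have := h l; case: ifP => _; [case=> -> -> | move=> ->; rewrite subrr].
rewrite -big_mkcond sumr_const -cardsE card_lt_ord /hw_weight.
rewrite -(inj_eq val_inj) -[il == i](inj_eq val_inj) /= i0E ilE.
rewrite [0%N == _]eq_sym [m.-1 == _]eq_sym.
have ne : (0%N == m.-1) = false.
  by apply/negbTE; have := i0l; rewrite -(inj_eq val_inj) /= i0E ilE.
case: (nat_of_ord i) => [|j]; first by rewrite ne /= subr0 natz.
by rewrite /=; case: eqP => _; rewrite sub0r ?mulNrn ?natz ?oppr0 ?mul0rn.
Qed.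

Lemma unitri_unit (u : 'M[C]_m) : upper_unitri u -> u \in unitmx.
Proof.
move=> hu; rewrite unitmxE -det_tr det_trig; last first.
  by apply/is_trig_mxP => i j ij; rewrite mxE; case: (hu j i) => ->.
rewrite big1 ?unitr1 // => i _; rewrite mxE; by case: (hu i i) => _ ->.
Qed.

(** The first column of [u] is that of the identity, and so is its last row. Conjugation by [u]
    therefore fixes E_{1m} in each slot. *)
Lemma unitri_delta (u : 'M[C]_m) : upper_unitri u ->
  u *m delta_mx i0 il = delta_mx i0 il /\ delta_mx i0 il *m u = delta_mx i0 il.
Proof.
move=> hu; split; apply/matrixP => i j; rewrite !mxE.
  rewrite (bigD1 i0) //= big1 ?addr0 => [|t t0]; last first.
    by rewrite mxE (negbTE t0) mulr0.
  rewrite mxE eqxx /=; have [->|ne] := eqVneq i i0.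
    by case: (hu i0 i0) => _ -> //; rewrite mul1r.
  case: (hu i i0) => -> //; rewrite ?mul0r // i0E lt0n.
  by apply: contra ne => /eqP e; exact/eqP/val_inj/(etrans e (esym i0E)).
rewrite (bigD1 il) //= big1 ?addr0 => [|t tl]; last first.
  by rewrite mxE (negbTE tl) andbF mul0r.
rewrite mxE eqxx andbT; have [->|ne] := eqVneq j il.
  by case: (hu il il) => _ -> //; rewrite mulr1 andbT.
case: (hu il j) => -> //; rewrite ?mulr0 ?andbF // ltn_neqAle le_last andbT.
by rewrite (inj_eq val_inj).
Qed.

Lemma hwX_HW : HW k hwX.
Proof.
split=> [|u hu]; first exact: hwX_weight.
rewrite /omegaGL conj_compress; apply: eq_compress => a b.
apply: eq_bigr => l _; have [h1 h2] := unitri_delta hu.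
have U := unitri_unit hu; rewrite /hwop; case: ifP => _.
  by rewrite h1 -{1}h2 -mulmxA mulmxV // mulmx1.
by rewrite mulmx1 mulmxV.
Qed.

Definition ones_unitri : 'M[C]_m := \matrix_(i, j) (i <= j)%N%:R.

Lemma ones_unitriP : upper_unitri ones_unitri.
Proof.
move=> i j; split=> [ji|->]; rewrite mxE ?leqnn //.
by rewrite leqNgt ji.
Qed.

(** The types |k,0,...,0,n-k> and |0,...,0,n> of these two words index the reference entry, where
    [hwX] is nonzero and to which the other entries are compared. *)
Definition hwa : word m n := [ffun l : 'I_n => if (l < k)%N then i0 else il].
Definition hwb : word m n := [ffun=> il].

Lemma tau_ones_neq0 v : tau n ones_unitri (v, word_type hwb) != 0.
Proof.
rewrite tauE -(word_type_rep v); apply: compress_gt0 => [a b|].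
  by apply: prodr_ge0 => l _; rewrite mxE.
rewrite /pointwise big1 ?ltr01 // => l _; rewrite mxE [hwb l]ffunE.
by rewrite le_last.
Qed.

Lemma hwX_neq0 : hwX (word_type hwa, word_type hwb) != 0.
Proof.
apply: compress_gt0 => [a b|]; first exact: pointwise_hwop_ge0.
rewrite pointwise_hwop; case: forallP => // -[l].
by rewrite !ffunE; case: (_ < _)%N; rewrite !eqxx.
Qed.

(* Invariance under a single matrix suffices: tau(ones_unitri) has a nonzero
   entry from |0,...,0,n> (the type of [hwb]) to every Fock state, so it ties
   every entry of X to one fixed entry. *)
Lemma HW_entry (X : Op R m n) x y : HW k X ->
  (forall i, (occ x i)%:Z - (occ y i)%:Z = hw_weight k i) ->
  X (x, y) * tau n ones_unitri (y, word_type hwb) =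
  tau n ones_unitri (x, word_type hwa) * X (word_type hwa, word_type hwb).
Proof.
move=> [wX invX] xy.
have U := unitri_unit ones_unitriP.
have e : opmul X (tau n ones_unitri) = opmul (tau n ones_unitri) X.
  rewrite -[in LHS](invX _ ones_unitriP) /omegaGL opmulA tauM mulVmx //.
  by rewrite opmul1.
have w0 := hwX_weight hwX_neq0.
have weq z : (forall i, (occ z i)%:Z - (occ (word_type hwb) i)%:Z = hw_weight k i) ->
    z = word_type hwa.
  move=> hz; apply: occ_inj => i; have := hz i; rewrite -(w0 i).
  by move=> /addIr [].
have weq' z : (forall i, (occ x i)%:Z - (occ z i)%:Z = hw_weight k i) -> z = y.
  move=> hz; apply: occ_inj => i; have := hz i; rewrite -(xy i).
  by move=> /addrI /oppr_inj [].
(* At this entry the weight condition leaves a single summand on each side of the commutation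
   relation. *)
move/ffunP: e => /(_ (x, word_type hwb)) e; rewrite [LHS]ffunE [RHS]ffunE /= in e.
move: e.
rewrite (bigD1 y) //= [X in _ + X]big1 => [|z zy]; last first.
  have [->|nz] := eqVneq (X (x, z)) 0; first by rewrite mul0r.
  by move: zy; rewrite (weq' z (wX _ _ nz)) eqxx.
rewrite addr0 (bigD1 (word_type hwa)) //= [X in _ = _ + X]big1 => [|z za]; last first.
  have [->|nz] := eqVneq (X (z, word_type hwb)) 0; first by rewrite mulr0.
  by move: za; rewrite (weq z (wX _ _ nz)) eqxx.
by rewrite addr0.
Qed.

(** By [HW_entry] the ratio of an entry of the right weight to the reference entry is the same for
    [X] and for [hwX]; all other entries vanish in both. *)
Lemma HW_unique (X : Op R m n) : HW k X -> exists c : C, X = c *: hwX.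
Proof.
move=> hX; exists (X (word_type hwa, word_type hwb) / hwX (word_type hwa, word_type hwb)).
apply/ffunP => -[x y]; rewrite ffunE.
have [|] := boolP [forall i, (occ x i)%:Z - (occ y i)%:Z == hw_weight k i].
  move=> /forallP h.
  have h' i : (occ x i)%:Z - (occ y i)%:Z = hw_weight k i by apply/eqP.
  apply: (mulIf (tau_ones_neq0 y)).
  rewrite HW_entry // -[RHS]mulrA HW_entry //; last exact: hwX_HW.
  by have := hwX_neq0; set t := hwX _ => nz; field.
rewrite negb_forall => /existsP[i hi].
have z (Y : Op R m n) : HW k Y -> Y (x, y) = 0.
  move=> [wY _]; apply/eqP; apply: contraR hi => nz; exact/eqP/wY.
by rewrite !z ?scaler0 //; apply: hwX_HW.
Qed.
End HighestWeight.

(** * Upper bound for the dimension *)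

Section Contraction.
Variables (R : realType) (m k : nat).
Local Notation C := R[i].
Variable i0 : 'I_m.
Implicit Types (al be : fock m k).

(** Totality needs a default: when [i0] is empty, the prescribed occupations sum to k+1, no state
    has them, and [al] is returned. *)
Definition move_from0 (i : 'I_m) al : fock m k :=
  odflt al [pick v : fock m k |
    [forall l, occ v l == (occ al l - (l == i0)) + (l == i)]%N].

Lemma occ_move_from0 i al l : (0 < occ al i0)%N ->
  occ (move_from0 i al) l = ((occ al l - (l == i0)) + (l == i))%N.
Proof.
move=> h0; rewrite /move_from0; case: pickP => [v /forallP h|h]; first exact/eqP.
have [|v hv] := @fock_exists m k (fun l => (occ al l - (l == i0)) + (l == i))%N.
  rewrite big_split /= -[RHS](sum_occ al).
  have -> : (\sum_j (j == i))%N = 1%N.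
    by rewrite (bigD1 i) //= eqxx big1 // => j /negbTE ->.
  rewrite (bigD1 i0) //= [RHS](bigD1 i0) //= eqxx addnAC subnK //.
  by congr addn; apply: eq_bigr => j /negbTE ->; rewrite subn0.
by move: (h v) => /forallP []; move=> j; rewrite hv.
Qed.

Lemma move_from0_id al : (0 < occ al i0)%N -> move_from0 i0 al = al.
Proof.
move=> h; apply: occ_inj => l; rewrite occ_move_from0 //.
by case: eqP => [->|_]; rewrite ?subnK // subn0 addn0.
Qed.

(** With [T] read as a mixed tensor of bidegree (k,k), symmetric in its upper and in its lower
    indices, this is the vanishing of its contraction. *)
Definition traceless (T : fock m k * fock m k -> C) : Prop :=
  forall al be, (0 < occ al i0)%N -> (0 < occ be i0)%N ->
    \sum_i T (move_from0 i al, move_from0 i be) = 0.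

Definition boundary : {set fock m k * fock m k} :=
  [set p | (occ p.1 i0 == 0)%N || (occ p.2 i0 == 0)%N].

(** Off the boundary, the trace relation expresses an entry through entries whose first index has
    one unit fewer at [i0]; induction on that occupation ends on the boundary. *)
Lemma traceless_eq0 T : traceless T ->
  (forall p, p \in boundary -> T p = 0) -> forall p, T p = 0.
Proof.
move=> tT bT [al be]; have [N] := ubnP (occ al i0).
elim: N al be => // N IH al be hN.
have [hb|] := boolP ((al, be) \in boundary); first exact: bT.
rewrite inE /= negb_or -!lt0n => /andP[ha hb].
have := tT al be ha hb; rewrite (bigD1 i0) //= !move_from0_id //.
rewrite big1 ?addr0 // => i ne; apply: IH.
by rewrite occ_move_from0 // eqxx eq_sym (negbTE ne) addn0 subn1 -ltnS prednK.
Qed.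

(** Moving a unit to [i] on both sides multiplies a factor common to all terms by [u i * w i], so
    the contraction is a multiple of the vanishing sum. *)
Lemma traceless_monomial (u w : 'I_m -> C) : \sum_i u i * w i = 0 ->
  traceless (fun p => (\prod_i u i ^+ occ p.1 i) * (\prod_i w i ^+ occ p.2 i)).
Proof.
move=> uw al be ha hb /=.
have e (t : 'I_m -> C) ga i : (0 < occ ga i0)%N ->
    \prod_l t l ^+ occ (move_from0 i ga) l =
    (\prod_l t l ^+ (occ ga l - (l == i0))) * t i.
  move=> hg; under eq_bigr do rewrite occ_move_from0 // exprD.
  rewrite big_split /=; congr (_ * _).
  by rewrite (bigD1 i) //= eqxx expr1 big1 ?mulr1 // => l /negbTE ->.
under eq_bigr do rewrite !e // mulrACA.
by rewrite -mulr_sumr uw mulr0.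
Qed.

End Contraction.

Section Dimension.
Variables (R : realType) (m n k : nat).
Local Notation C := R[i].
Hypothesis (kn : (k <= n)%N).
Variables i0 il : 'I_m.
Hypotheses (i0E : val i0 = 0%N) (ilE : val il = m.-1) (i0l : i0 != il).
Implicit Types (a b : word m n) (g : 'M[C]_m).

Lemma scale_opE (c : C) (X : Op R m n) p : (c *: X) p = c * X p.
Proof. by rewrite ffunE. Qed.

Lemma prefix_type_exists a : exists v : fock m k,
  [forall i, occ v i == #|[set l : 'I_n in [set l : 'I_n | (l < k)%N] | a l == i]|].
Proof.
have [|v hv] := @fock_exists m k
    (fun i => #|[set l : 'I_n in [set l : 'I_n | (l < k)%N] | a l == i]|).
  by rewrite sum_card_fiber card_lt_ord.
by exists v; apply/forallP => i; rewrite hv.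
Qed.

Definition prefix_type a : fock m k := xchoose (prefix_type_exists a).

Lemma occ_prefix_type a i :
  occ (prefix_type a) i = #|[set l : 'I_n | (l < k)%N && (a l == i)]|.
Proof.
move/forallP: (xchooseP (prefix_type_exists a)) => /(_ i) /eqP ->.
by apply: eq_card => l; rewrite !inE.
Qed.

Lemma prod_prefix (u : 'I_m -> C) a :
  \prod_(l < n | (l < k)%N) u (a l) = \prod_i u i ^+ occ (prefix_type a) i.
Proof.
rewrite (partition_big a xpredT) //=; apply: eq_bigr => i _.
rewrite (eq_bigr (fun=> u i)) => [|l /andP[_ /eqP ->]] //.
by rewrite prodr_const occ_prefix_type cardsE.
Qed.

(** The operator that multiplies the monomial u^alpha w^beta when the first [k] slots carry the
    rank-one matrix u w^T and the others the identity. *)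
Definition transfer_op (p : fock m k * fock m k) : Op R m n :=
  compress (fun a b => ((prefix_type a, prefix_type b) == p)%:R *
    \prod_(l < n | ~~ (l < k)%N) (a l == b l)%:R).

(** Conjugation turns E_{1m} into the rank-one matrix built from the first column of [g] and the
    conjugate of its last column, orthogonal by unitarity, and it leaves the identity slots
    alone. *)
Lemma omega_hwX g : is_SU g -> exists u w : 'I_m -> C,
  \sum_i u i * w i = 0 /\
  omega g (hwX R n k i0 il) = \sum_p ((\prod_i u i ^+ occ p.1 i) *
     (\prod_i w i ^+ occ p.2 i)) *: transfer_op p.
Proof.
move=> [gU _]; exists (fun i => g i i0), (fun j => (g j il)^*); split.
  have := mulmx1C gU; rewrite -/(ctr g) => /matrixP /(_ il i0).
  rewrite !mxE eq_sym (negbTE i0l) => h; rewrite -[RHS]h.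
  by apply: eq_bigr => i _; rewrite !mxE mulrC.
rewrite omegaE conj_compress; apply/ffunP => -[x y]; rewrite sum_ffunE ffunE /=.
under [RHS]eq_bigr do rewrite scale_opE ffunE /= mulrCA mulr_sumr.
rewrite -mulr_sumr; congr (_ * _); rewrite [RHS]exchange_big /=.
apply: eq_bigr => a _; under [RHS]eq_bigr do rewrite mulr_sumr.
rewrite [RHS]exchange_big /=; apply: eq_bigr => b _.
rewrite [RHS](bigD1 (prefix_type a, prefix_type b)) //= eqxx mul1r.
rewrite [X in _ + X]big1 => [|p ne]; last first.
  by rewrite eq_sym (negbTE ne) mul0r mulr0.
rewrite addr0 -!prod_prefix -big_split /= /pointwise (bigID (fun l : 'I_n => (l < k)%N)) /=.
congr (_ * _); apply: eq_bigr => l hl; last first.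
  by rewrite /hwop (negbTE hl) mulmx1 gU mxE.
rewrite /hwop hl mxE (bigD1 il) //= big1 => [|j jl]; last first.
  by rewrite mxE big1 ?mul0r // => t _; rewrite mxE (negbTE jl) andbF mulr0.
rewrite !mxE (bigD1 i0) //= big1 => [|j j0]; last first.
  by rewrite mxE (negbTE j0) mulr0.
by rewrite !mxE !eqxx mulr1 !addr0.
Qed.

Lemma omega_scale g (c : C) (X : Op R m n) : omega g (c *: X) = c *: omega g X.
Proof.
apply/ffunP => p; rewrite scale_opE [LHS]ffunE [in RHS]ffunE mulr_sumr.
apply: eq_bigr => z _; rewrite mulrA; congr (_ * _).
rewrite [LHS]ffunE [in RHS]ffunE mulr_sumr; apply: eq_bigr => t _.
by rewrite scale_opE mulrCA.
Qed.

(** By uniqueness each generator is a multiple of a translate of [hwX], hence comes from a traceless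
    array of monomials; such arrays are closed under linear combination. *)
Lemma Vcomp_transfer (X : Op R m n) : Vcomp k X ->
  exists T : fock m k * fock m k -> C,
    traceless i0 T /\ X = \sum_p T p *: transfer_op p.
Proof.
move=> [s [hs ->]]; elim: s hs => [|q s IH] hs.
  exists (fun=> 0); split; first by move=> *; rewrite big1.
  by rewrite big_nil big1 // => p _; rewrite scale0r.
have [|T [tT eT]] := IH; first by move=> p ps; apply: hs; rewrite inE ps orbT.
have [SU HWq] := hs q (mem_head _ _).
have [c eq2] := HW_unique kn i0E ilE i0l HWq.
have [u [w [uw e]]] := omega_hwX SU.
exists (fun p => c * ((\prod_i u i ^+ occ p.1 i) * (\prod_i w i ^+ occ p.2 i)) + T p).
split=> [al be ha hb|].
  rewrite big_split /= -mulr_sumr tT // addr0.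
  by rewrite (traceless_monomial uw) // mulr0.
rewrite big_cons eT eq2 omega_scale e scaler_sumr -big_split /=.
by apply: eq_bigr => p _; rewrite scalerDl scalerA.
Qed.

(** A traceless array is determined by its restriction to [boundary], so independence passes from
    the operators to the rows of restricted arrays. *)
Lemma Vcomp_indep_bound (I : finType) (Y : I -> Op R m n) :
  (forall i, Vcomp k (Y i)) ->
  (forall c : I -> C, \sum_i c i *: Y i = 0 -> forall i, c i = 0) ->
  (#|I| <= #|boundary k i0|)%N.
Proof.
move=> VY indep.
have /fin_all_exists[T hT] := fun i => Vcomp_transfer (VY i).
pose A : 'M[C]_(#|I|, #|boundary k i0|) := \matrix_(i, j) T (enum_val i) (enum_val j).
suff /eqP <- : row_free A by apply: rank_leq_col.
apply: inj_row_free => v vA.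
pose c i := v 0 (enum_rank i).
have z p : \sum_i c i * T i p = 0.
  apply: (@traceless_eq0 _ _ _ i0 (fun p => \sum_i c i * T i p)) => [al be ha hb|q qb].
    rewrite exchange_big big1 //= => i _.
    by rewrite -mulr_sumr (proj1 (hT i)) // mulr0.
  move/matrixP: vA => /(_ 0 (enum_rank_in qb q)); rewrite !mxE => h.
  rewrite -[RHS]h (reindex_onto enum_rank enum_val) /=; last by move=> *; apply: enum_valK.
  apply: eq_big => [i|i _]; first by rewrite enum_rankK eqxx.
  by rewrite !mxE enum_rankK enum_rankK_in.
apply/rowP => j; rewrite mxE -[j]enum_valK; apply: (indep c).
rewrite (eq_bigr (fun i => \sum_p (c i * T i p) *: transfer_op p)) => [|i _]; last first.
  by rewrite {1}(proj2 (hT i)) scaler_sumr; apply: eq_bigr => p _; rewrite scalerA.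
rewrite exchange_big big1 //= => p _.
by rewrite -scaler_suml z scale0r.
Qed.
End Dimension.

(** * Gelfand-Tsetlin patterns *)

Section Patterns.
Variables (m k : nat).
Variables i0 il : 'I_m.
Hypotheses (i0E : val i0 = 0%N) (ilE : val il = m.-1) (i0l : i0 != il).
Implicit Types (al be : fock m k).

Definition psum al (j : 'I_m) : nat := (\sum_(l < m | (l <= j)%N) occ al l)%N.

Lemma psum_le al j : (psum al j <= k)%N.
Proof.
rewrite -[X in (_ <= X)%N](sum_occ al).
by rewrite [X in (_ <= X)%N](bigID (fun l : 'I_m => l <= j)%N) leq_addr.
Qed.

Lemma psum_mono al (j j' : 'I_m) : (j <= j')%N -> (psum al j <= psum al j')%N.
Proof.
move=> jj; rewrite /psum [X in (_ <= X)%N](bigID (fun l : 'I_m => l <= j)%N) /=.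
apply: leq_trans (leq_addr _ _); rewrite leq_eqVlt; apply/orP; left; apply/eqP.
apply: eq_bigl => l; case: leqP => h; rewrite ?andbF // andbT.
by rewrite (leq_trans h jj).
Qed.

Lemma psum_last al : psum al il = k.
Proof.
rewrite -[RHS](sum_occ al); apply: eq_bigl => l; exact: (le_last ilE).
Qed.

(** The sum over [j'] picks the predecessor of [j] and is empty at the first index, so no case
    distinction is needed. *)
Lemma psum_step al (j : 'I_m) :
  psum al j = (\sum_(j' < m | j'.+1 == j) psum al j' + occ al j)%N.
Proof.
rewrite /psum (bigD1 j) //= addnC; congr addn.
case ej : (nat_of_ord j) => [|t].
  rewrite [RHS]big1 => [|j' /eqP //]; rewrite big1 // => l /andP[l0 lj].
  by case/negP: lj; apply/eqP/val_inj; rewrite /= ej; apply/eqP; rewrite -leqn0.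
have tm : (t < m)%N by have := ltn_ord j; rewrite ej => /ltnW.
rewrite [RHS](big_pred1 (Ordinal tm)) => [|j']; last by rewrite /= eqSS.
apply: eq_bigl => l; rewrite -(inj_eq val_inj) /= ej.
by lia.
Qed.

(** The subtraction never truncates, since partial sums of [be] are at most [k]. *)
Definition pattern_entry al be (i j : 'I_m) : nat :=
  if (i <= j)%N then (k + (i == i0) * psum al j - (i == j) * psum be j)%N else 0%N.

Lemma pattern_exists (p : fock m k * fock m k) :
  exists M : GTpat (@lam m k), forall i j, Mv M i j = pattern_entry p.1 p.2 i j.
Proof.
case: p => al be /=.
pose B := (\max_(i < m) @lam m k i)%N.
have lamB : (k.*2 <= B)%N.
  have -> : k.*2 = @lam m k i0 by rewrite /lam i0E eqxx.
  exact: leq_bigmax.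
have leB i j : (pattern_entry al be i j < B.+1)%N.
  rewrite ltnS; apply: leq_trans lamB; rewrite /pattern_entry.
  have := psum_le al j; case: ifP => // _; case: (i == i0) => /=; lia.
pose F : {ffun 'I_m * 'I_m -> 'I_B.+1} := [ffun p => Ordinal (leB p.1 p.2)].
have FE i j : val (F (i, j)) = pattern_entry al be i j by rewrite ffunE.
have i0P (i : 'I_m) : (i == i0) = (val i == 0%N).
  by rewrite -(inj_eq val_inj) i0E.
suff GF : isGT (@lam m k) F by exists (exist _ F GF) => i j; rewrite /Mv /= ffunE.
apply/and4P; split.
- apply/forallP => i; apply/forallP => j; apply/implyP => ji.
  by rewrite FE /pattern_entry leqNgt ji.
- apply/forallP => i; apply/forallP => j; apply/implyP => /eqP jm.
  have -> : j = il by apply: val_inj; rewrite jm ilE.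
  rewrite FE /pattern_entry (le_last ilE) !psum_last /lam.
  rewrite -(inj_eq val_inj i il) ilE -i0P.
  have [->|_] := eqVneq i i0.
    move: i0l; rewrite -(inj_eq val_inj) ilE => /negbTE ->.
    by apply/eqP; lia.
  by case: (val i == m.-1); apply/eqP; lia.
(* Along a row only the diagonal entry carries a [be] term, and the [al] term does not decrease. *)
- apply/forallP => i; apply/forallP => j; apply/forallP => j'.
  apply/implyP => /andP[/eqP j'E ij]; rewrite !FE /pattern_entry ij.
  have ij' : (i <= j')%N by apply: leq_trans ij _; rewrite [X in (_ <= X)%N]j'E.
  rewrite ij'.
  have -> : (i == j') = false.
    by apply/negbTE; rewrite -(inj_eq val_inj) j'E neq_ltn ltnS ij.
  have := @psum_mono al j j'; rewrite [X in (_ <= X)%N -> _]j'E leqnSn => /(_ isT).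
  by case: (i == i0) => /=; lia.
(* Row [i'] is not the first, so it carries no [al] term, and the partial sums subtracted on the
   diagonal do not decrease. *)
- apply/forallP => i; apply/forallP => i'; apply/forallP => j; apply/forallP => j'.
  apply/implyP => /and3P[/eqP i'E /eqP j'E ij]; rewrite !FE /pattern_entry ij.
  have -> : (i' == i0) = false by rewrite i0P i'E.
  have -> : (i' == j') = (i == j) by rewrite -!(inj_eq val_inj) i'E j'E eqSS.
  have := @psum_mono be j j'; rewrite [X in (_ <= X)%N -> _]j'E leqnSn => /(_ isT).
  have := psum_le be j'; have := psum_le be j.
  by case: ifP => // _; case: (i == j) => /=; lia.
Qed.

Lemma pattern_rowsum al be (M : GTpat (@lam m k)) (j : 'I_m) :
  (forall i j, Mv M i j = pattern_entry al be i j) ->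
  (\sum_(i < m | (i <= j)%N) Mv M i j)%:Z =
  (\sum_(i < m | (i <= j)%N) k)%:Z + (psum al j)%:Z - (psum be j)%:Z.
Proof.
move=> hM.
have i0j : (i0 <= j)%N by rewrite -[nat_of_ord i0]/(val i0) i0E.
(* The [be] term goes to the other side, which keeps natural-number subtraction out of the sums. *)
have h : (\sum_(i < m | (i <= j)%N) (Mv M i j + (i == j) * psum be j) =
    \sum_(i < m | (i <= j)%N) (k + (i == i0) * psum al j))%N.
  apply: eq_bigr => i ij; rewrite hM /pattern_entry ij subnK //.
  by have := psum_le be j; case: (i == j) => /=; lia.
have pick1 (t : 'I_m) (c : nat) : (t <= j)%N ->
    (\sum_(i < m | (i <= j)%N) (i == t) * c = c)%N.
  move=> tj; rewrite (bigD1 t) //= eqxx mul1n big1 ?addn0 // => i /andP[_ /negbTE ->].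
  by rewrite mul0n.
move: h; rewrite !big_split /= !pick1 //; lia.
Qed.

Lemma pattern_wt al be (M : GTpat (@lam m k)) (j : 'I_m) :
  (forall i j, Mv M i j = pattern_entry al be i j) ->
  wt M j = k%:Z + (occ al j)%:Z - (occ be j)%:Z.
Proof.
move=> hM; rewrite /wt (pattern_rowsum _ hM).
have -> : (\sum_(j' < m | (j'.+1 == j)%N) \sum_(i < m | (i <= j')%N) Mv M i j')%:Z
   = (\sum_(j' < m | (j'.+1 == j)%N) \sum_(i < m | (i <= j')%N) k)%:Z
     + (\sum_(j' < m | (j'.+1 == j)%N) psum al j')%:Z
     - (\sum_(j' < m | (j'.+1 == j)%N) psum be j')%:Z.
  rewrite -![Posz _]natz !natr_sum -big_split /= -sumrB; apply: eq_bigr => j' _.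
  by rewrite !natz -(pattern_rowsum _ hM).
have -> : (\sum_(i < m | (i <= j)%N) k = k +
   \sum_(j' < m | (j'.+1 == j)%N) \sum_(i < m | (i <= j')%N) k)%N.
  rewrite (bigD1 j) //=; congr addn.
  case ej : (nat_of_ord j) => [|t].
    rewrite [RHS]big1 => [|j' /eqP //]; rewrite big1 // => l /andP[l0 lj].
    by case/negP: lj; apply/eqP/val_inj; rewrite /= ej; apply/eqP; rewrite -leqn0.
  have tm : (t < m)%N by have := ltn_ord j; rewrite ej => /ltnW.
  rewrite [RHS](big_pred1 (Ordinal tm)) => [|j']; last by rewrite /= eqSS.
  apply: eq_bigl => l; rewrite -(inj_eq val_inj) /= ej; lia.
have := psum_step al j; have := psum_step be j; lia.
Qed.

Lemma psum_inj al al' : (forall j, psum al j = psum al' j) -> al = al'.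
Proof.
move=> h; apply: occ_inj => j; apply: (@addnI (\sum_(j' < m | j'.+1 == j) psum al j')).
by rewrite -psum_step h psum_step; congr addn; apply: eq_bigr => i _; rewrite h.
Qed.

(** Away from [i0], the entries (i0,j) and (j,j) reveal the two partial sums separately. At [i0]
    only the difference of the first occupations is visible, and it determines both because one of
    them is zero. *)
Lemma pattern_entry_inj : {in boundary k i0 &, forall p q,
  (forall i j, pattern_entry p.1 p.2 i j = pattern_entry q.1 q.2 i j) -> p = q}.
Proof.
move=> [al be] [al' be']; rewrite !inE /= => h1 h2 e.
have le0 (j : 'I_m) : (i0 <= j)%N by rewrite -[nat_of_ord i0]/(val i0) i0E.
have p0 (ga : fock m k) : psum ga i0 = occ ga i0.
  rewrite psum_step big1 // => j'; rewrite -[nat_of_ord i0]/(val i0) i0E.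
  by move=> /eqP.
have E0 : (occ al i0 = occ al' i0) /\ (occ be i0 = occ be' i0).
  have := e i0 i0; rewrite /pattern_entry leqnn eqxx !mul1n.
  have := psum_le al i0; have := psum_le al' i0.
  have := psum_le be i0; have := psum_le be' i0; rewrite !p0.
  by move: h1 h2; do 2![case/orP => /eqP ->]; lia.
have En (j : 'I_m) : j != i0 -> psum al j = psum al' j /\ psum be j = psum be' j.
  move=> ne; have := e i0 j; rewrite /pattern_entry le0 eqxx mul1n.
  rewrite [i0 == j]eq_sym (negbTE ne) mul0n.
  have := e j j; rewrite /pattern_entry leqnn (negbTE ne) eqxx !mul1n !mul0n.
  by have := psum_le be j; have := psum_le be' j; lia.
by congr (_, _); apply: psum_inj => j; have [->|ne] := eqVneq j i0;
   rewrite ?p0; [case: E0|case: (En _ ne)|case: E0|case: (En _ ne)].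
Qed.

Lemma pattern_function : exists Phi : fock m k * fock m k -> GTpat (@lam m k),
  {in boundary k i0 &, injective Phi} /\
  forall p i, wt (Phi p) i = k%:Z + (occ p.1 i)%:Z - (occ p.2 i)%:Z.
Proof.
have /fin_all_exists[Phi hP] := pattern_exists; exists Phi; split.
  move=> p q hp hq e; apply: pattern_entry_inj => // i j.
  by rewrite -!hP e.
by move=> p i; apply: pattern_wt.
Qed.

Lemma card_boundary_le : (#|boundary k i0| <= #|{: GTpat (@lam m k)}|)%N.
Proof.
have [Phi [inj _]] := pattern_function.
by rewrite -(card_in_imset inj) max_card.
Qed.

(** Equal cardinalities make the injection from [boundary] onto. A pattern of zero SU(m)-weight, all
    row weights equal to [k], then comes from a pair with [al = be], and on the boundary this forces
    an empty first mode. *)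
Lemma card_zero_weight : #|{: GTpat (@lam m k)}| = #|boundary k i0| ->
  #|[set M : GTpat (@lam m k) | [forall j, wt M j == k%:Z]]| =
  #|[set al : fock m k | occ al i0 == 0%N]|.
Proof.
move=> e; have [Phi [inj wtP]] := pattern_function.
have full : Phi @: boundary k i0 = setT.
  by apply/eqP; rewrite eqEcard subsetT cardsT card_in_imset //= -e leqnn.
have dB al : occ al i0 = 0%N -> (al, al) \in boundary k i0 by move=> h; rewrite inE h.
have diag_inj : {in [set al : fock m k | occ al i0 == 0%N] &,
    injective (fun al => Phi (al, al))}.
  move=> al al'; rewrite !inE => /eqP h /eqP h' e2.
  by have [] := inj _ _ (dB _ h) (dB _ h') e2.
rewrite -(card_in_imset diag_inj).
apply: eq_card => M; rewrite inE; apply/forallP/imsetP => [h|[al _ ->] j]; last first.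
  by rewrite wtP /= addrK.
have : M \in Phi @: boundary k i0 by rewrite full inE.
case/imsetP => -[al be] hB eM.
have eab : al = be.
  apply: occ_inj => i; have := h i; rewrite eM wtP /= => /eqP.
  lia.
exists al; last by rewrite eM eab.
by move: hB; rewrite !inE -eab /= orbb.
Qed.

End Patterns.

(** * Counting occupation vectors *)

Lemma card_fock (m k : nat) : #|{: fock m.+1 k}| = 'C(k + m, m).
Proof.
rewrite addnC -(card_ord_partitions m k).
pose f (al : fock m.+1 k) : m.+1.-tuple 'I_k.+1 := [tuple sval al i | i < m.+1].
have fi : injective f.
  move=> al be e; apply/val_inj/ffunP => i.
  by have := congr1 (fun t => tnth t i) e; rewrite !tnth_mktuple.
rewrite -cardsT -(card_imset _ fi); apply: eq_card => t; rewrite inE.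
apply/imsetP/eqP => [[al _ ->]|ht].
  by rewrite -[RHS](sum_occ al) big_tuple; apply: eq_bigr => i _; rewrite tnth_mktuple.
have [|al hal] := @fock_exists m.+1 k (fun i => tnth t i).
  by rewrite -[RHS]ht big_tuple.
exists al => //; apply: eq_from_tnth => i; rewrite tnth_mktuple.
by apply: val_inj; rewrite /= -hal.
Qed.

Lemma card_fock_ord0 (m k : nat) :
  #|[set al : fock m.+2 k | occ al ord0 == 0%N]| = #|{: fock m.+1 k}|.
Proof.
have ex (be : fock m.+1 k) : exists al : fock m.+2 k,
    occ al ord0 = 0%N /\ forall i, occ al (lift ord0 i) = occ be i.
  have [|al hal] := @fock_exists m.+2 k
     (fun i => if unlift ord0 i is Some j then occ be j else 0%N).
    rewrite big_ord_recl unlift_none add0n -[RHS](sum_occ be).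
    by apply: eq_bigr => i _; rewrite liftK.
  by exists al; split=> [|i]; rewrite hal ?unlift_none ?liftK.
have /fin_all_exists[f hf] := ex.
have fi : injective f.
  by move=> be be' e; apply: occ_inj => i; rewrite -!(proj2 (hf _)) e.
rewrite -cardsT -(card_imset _ fi); apply: eq_card => al; rewrite inE.
apply/eqP/imsetP => [h|[be _ ->]]; last by case: (hf be).
have [|be hbe] := @fock_exists m.+1 k (fun i => occ al (lift ord0 i)).
  by rewrite -[RHS](sum_occ al) [RHS]big_ord_recl h.
exists be => //; apply: occ_inj => i; case: (unliftP ord0 i) => [j|] ->.
  by rewrite (proj2 (hf _)) hbe.
by rewrite h (proj1 (hf _)).
Qed.

(** * The projector *)

Section HilbertSchmidt.
Variables (R : realType) (m n : nat).
Local Notation C := R[i].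
Implicit Types (A B X Y : Op R m n) (v w : fock m n).

Lemma hsD A X Y : hs A (X + Y) = hs A X + hs A Y.
Proof.
by rewrite /hs -big_split; apply: eq_bigr => p _; rewrite ffunE mulrDr.
Qed.

Lemma hsZ A c X : hs A (c *: X) = c * hs A X.
Proof.
by rewrite /hs mulr_sumr; apply: eq_bigr => p _; rewrite scale_opE mulrCA.
Qed.

Lemma hs0 A : hs A 0 = 0.
Proof. by rewrite /hs big1 // => p _; rewrite ffunE mulr0. Qed.

Lemma hsB A X Y : hs A (X - Y) = hs A X - hs A Y.
Proof. by rewrite -scaleN1r hsD hsZ mulN1r. Qed.

Lemma hs_sum A (I : finType) (F : I -> Op R m n) :
  hs A (\sum_i F i) = \sum_i hs A (F i).
Proof. exact: (big_morph _ (hsD A) (hs0 A)). Qed.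

Lemma hs_ketbra A v : hs A (ketbra R v v) = (A (v, v))^*.
Proof.
rewrite /hs (bigD1 (v, v)) //= ffunE !eqxx mulr1 big1 ?addr0 // => -[x y] ne.
by rewrite ffunE /= -xpair_eqE (negbTE ne) mulr0.
Qed.

Lemma VcompD k X Y : Vcomp k X -> Vcomp k Y -> Vcomp k (X + Y).
Proof.
move=> [s [hs1 ->]] [t [ht ->]]; exists (s ++ t); split; last by rewrite big_cat.
by move=> p; rewrite mem_cat => /orP[/hs1|/ht].
Qed.

Lemma HWZ k c X : HW k X -> HW k (c *: X).
Proof.
move=> [h1 h2]; split=> [x y|u hu].
  rewrite scale_opE => nz; apply: h1; apply: contra nz => /eqP ->.
  by rewrite mulr0.
rewrite -[in RHS](h2 u hu); apply/ffunP => p.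
rewrite scale_opE ![LHS]ffunE [in RHS]ffunE mulr_sumr.
apply: eq_bigr => z _; rewrite mulrA; congr (_ * _).
rewrite [LHS]ffunE [in RHS]ffunE mulr_sumr; apply: eq_bigr => t _.
by rewrite scale_opE mulrCA.
Qed.

Lemma VcompZ k c X : Vcomp k X -> Vcomp k (c *: X).
Proof.
move=> [s [h ->]]; exists [seq (p.1, c *: p.2) | p <- s]; split.
  by move=> _ /mapP[p /h[h1 h2] ->]; split=> //; apply: HWZ.
rewrite big_map scaler_sumr; apply: eq_bigr => p _ /=.
by rewrite omega_scale.
Qed.

Lemma Vcomp0 k : Vcomp k (0 : Op R m n).
Proof. by exists [::]; split=> //; rewrite big_nil. Qed.

Lemma Vcomp_sum k (I : finType) (F : I -> Op R m n) :
  (forall i, Vcomp k (F i)) -> Vcomp k (\sum_i F i).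
Proof. by move=> h; apply: big_ind => //; [exact: Vcomp0|exact: VcompD]. Qed.

Lemma add_opE X Y p : (X + Y) p = X p + Y p.
Proof. by rewrite ffunE. Qed.

Lemma omegaD (g : 'M[C]_m) X Y : omega g (X + Y) = omega g X + omega g Y.
Proof.
apply/ffunP => p; rewrite ![in RHS]ffunE [LHS]ffunE -big_split /=.
apply: eq_bigr => z _; rewrite -mulrDl; congr (_ * _).
rewrite ![in RHS]ffunE [LHS]ffunE -big_split /=; apply: eq_bigr => t _.
by rewrite add_opE mulrDr.
Qed.

Lemma omega0 (g : 'M[C]_m) : omega g (0 : Op R m n) = 0.
Proof. by rewrite -[X in omega _ X](scale0r (0 : Op R m n)) omega_scale scale0r. Qed.

Lemma omega_sum (g : 'M[C]_m) (I : finType) (F : I -> Op R m n) :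
  omega g (\sum_i F i) = \sum_i omega g (F i).
Proof. exact: (big_morph _ (omegaD g) (omega0 g)). Qed.

Lemma omega_diag (g : 'M[C]_m) X v : (forall x y, X (x, y) != 0 -> x = y) ->
  omega g X (v, v) = \sum_w X (w, w) * `|tau_el g v w| ^+ 2.
Proof.
move=> hX; rewrite ffunE; apply: eq_bigr => w _.
rewrite [in LHS]ffunE /= (bigD1 w) //= big1 => [|z zw]; last first.
  have [->|/hX e] := eqVneq (X (z, w)) 0; first by rewrite mulr0.
  by rewrite e eqxx in zw.
by rewrite addr0 /adj !ffunE /= normCK [RHS]mulrA [X _ * _]mulrC.
Qed.

End HilbertSchmidt.

(** * The orthonormal family as a basis of the component *)

Section Basis.
Variables (R : realType) (m n k : nat).
Local Notation C := R[i].
Hypotheses (Hm : (2 <= m)%N) (Hk : (k <= n)%N).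
Variables (b : GTpat (@lam m k) -> Op R m n).
Hypothesis (Hb : GT_basis b).
Implicit Types (v w : fock m n) (M : GTpat (@lam m k)).

Let lt0m : (0 < m)%N. Proof. exact: ltnW. Qed.
Let ltm : (m.-1 < m)%N. Proof. by rewrite prednK. Qed.
Let i0 : 'I_m := Ordinal lt0m.
Let il : 'I_m := Ordinal ltm.
Let i0E : val i0 = 0%N. Proof. by []. Qed.
Let ilE : val il = m.-1. Proof. by []. Qed.
Let i0l : i0 != il.
Proof. by rewrite -(inj_eq val_inj) /=; case: (m) Hm => // -[]. Qed.

Lemma hs_GT_basis (c : GTpat (@lam m k) -> C) M :
  hs (b M) (\sum_M' c M' *: b M') = c M.
Proof.
case: Hb => _ on _ _; rewrite hs_sum (bigD1 M) //= hsZ on eqxx mulr1.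
rewrite big1 => [|M' ne]; first exact: addr0.
by rewrite hsZ on eq_sym (negbTE ne) mulr0.
Qed.

Lemma GT_basis_indep (c : GTpat (@lam m k) -> C) :
  \sum_M c M *: b M = 0 -> forall M, c M = 0.
Proof.
by move=> e M; rewrite -(hs_GT_basis c M) e hs0.
Qed.

(** The bound on independent families meets the injection of [boundary] into the patterns. *)
Lemma card_GT : #|{: GTpat (@lam m k)}| = #|boundary k i0|.
Proof.
apply/eqP; rewrite eqn_leq (card_boundary_le k i0E ilE i0l) andbT.
apply: (Vcomp_indep_bound Hk i0E ilE i0l (Y := b)); first by case: Hb.
exact: GT_basis_indep.
Qed.

(** A nonzero residue [D], orthogonal to every [b M], would extend the family to an independent one
    that exceeds the bound by one. *)
Lemma GT_basis_expand X : Vcomp k X -> X = \sum_M hs (b M) X *: b M.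
Proof.
move=> VX; apply/eqP; rewrite -subr_eq0; set D := X - _; apply/negP => /negP nz.
have VD : Vcomp k D.
  apply: VcompD => //; rewrite -scaleN1r; apply/VcompZ/Vcomp_sum => M.
  by apply: VcompZ; case: Hb.
have hD M : hs (b M) D = 0 by rewrite hsB hs_GT_basis subrr.
pose Y (t : unit + GTpat (@lam m k)) := if t is inr M then b M else D.
have : (#|{: unit + GTpat (@lam m k)}| <= #|boundary k i0|)%N.
  apply: (Vcomp_indep_bound Hk i0E ilE i0l (Y := Y)) => [[]|c].
  - by [].
  - by case: Hb.
  rewrite big_sumType /= (big_pred1 tt) => [|[]] //= e.
  have cM M : c (inr M) = 0.
    have := hs0 (b M); rewrite -e hsD hsZ hD mulr0 add0r.
    by rewrite (hs_GT_basis (c \o inr)).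
  have z0 : \sum_i c (inr i) *: b i = 0.
    by apply: big1 => M _; rewrite cM scale0r.
  have /eqP : c (inl tt) *: D = 0.
    by move: e; rewrite z0; apply: etrans; rewrite [RHS]addr0.
  rewrite scaler_eq0 (negbTE nz) orbF => /eqP c0.
  by case=> [[]|M].
by rewrite card_sum card_unit card_GT ltnn.
Qed.

(** One inequality is the bound on independent families; for the other, the coordinates of the [b M]
    in a spanning sequence form a matrix with independent rows. *)
Lemma Vcomp_dim d : is_dim (@Vcomp R m n k) d -> d = #|boundary k i0|.
Proof.
move=> [s [<- Vs li sp]]; apply/eqP; rewrite eqn_leq; apply/andP; split.
  rewrite -[X in (X <= _)%N]card_ord.
  apply: (Vcomp_indep_bound Hk i0E ilE i0l (Y := fun i : 'I_(size s) => s`_i)) => [i|c].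
    exact/Vs/mem_nth.
  exact: li.
rewrite -card_GT.
have /fin_all_exists[c hc] : forall M, exists c : 'I_(size s) -> C, b M = \sum_i c i *: s`_i.
  by move=> M; apply: sp; case: Hb.
pose A : 'M[C]_(#|{: GTpat (@lam m k)}|, size s) := \matrix_(i, j) c (enum_val i) j.
suff /eqP <- : row_free A by apply: rank_leq_col.
apply: inj_row_free => v vA; apply/rowP => j; rewrite mxE -[j]enum_valK.
apply: (GT_basis_indep (c := fun M => v 0 (enum_rank M))).
rewrite (eq_bigr (fun M => \sum_i (v 0 (enum_rank M) * c M i) *: s`_i)) => [|M _]; last first.
  by rewrite {1}hc scaler_sumr; apply: eq_bigr => i _; rewrite scalerA.
rewrite exchange_big big1 //= => i _; rewrite -scaler_suml.
move/matrixP: vA => /(_ 0 i); rewrite !mxE => e.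
suff -> : \sum_M v 0 (enum_rank M) * c M i = 0 by rewrite scale0r.
rewrite -[RHS]e (reindex_onto enum_rank enum_val) /=; last by move=> *; apply: enum_valK.
apply: eq_big => [M|M _]; first by rewrite enum_rankK eqxx.
by rewrite mxE enum_rankK.
Qed.

Lemma GT_real M p : (b M p)^* = b M p.
Proof. by case: Hb => _ _ r _; apply: conj_Creal. Qed.

Lemma projector_ketbra (P : Op R m n -> Op R m n) v :
  is_orth_proj (@Vcomp R m n k) P ->
  P (ketbra R v v) = \sum_M b M (v, v) *: b M.
Proof.
move=> HP; have [VP oP] := HP (ketbra R v v).
rewrite (GT_basis_expand VP); apply: eq_bigr => M _; congr (_ *: _).
have /eqP := oP (b M) (let: And4 h _ _ _ := Hb in h M).
by rewrite hsB subr_eq0 => /eqP <-; rewrite hs_ketbra GT_real.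
Qed.

Lemma nonzero_weight_diag M v : (exists j, wt M j != k%:Z) -> b M (v, v) = 0.
Proof.
move=> [j hj]; apply/eqP; apply: contraR hj => nz.
case: Hb => _ _ _ /(_ M v v nz j); rewrite subrr => /esym /eqP.
by rewrite subr_eq0.
Qed.

Lemma zero_weight_diag M : (forall j, wt M j = k%:Z) ->
  forall x y, b M (x, y) != 0 -> x = y.
Proof.
move=> h x y nz; apply: occ_inj => i; case: Hb => _ _ _ /(_ M x y nz i).
by rewrite h subrr => /eqP; rewrite subr_eq0 => /eqP [].
Qed.

Lemma GT_weight_cases M : (forall j, wt M j = k%:Z) \/ exists j, wt M j != k%:Z.
Proof.
have [/forallP h|] := boolP [forall j, wt M j == k%:Z].
  by left=> j; apply/eqP.
by rewrite negb_forall => /existsP; right.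
Qed.

(** A zero-weight [b M] is a diagonal operator, so the sum is its full squared norm; any other [b M]
    has zero diagonal. *)
Lemma sum_diag_sqr M :
  \sum_v b M (v, v) * b M (v, v) = [forall j, wt M j == k%:Z]%:R.
Proof.
have [h|h] := GT_weight_cases M; last first.
  rewrite big1 => [|v _]; last by rewrite nonzero_weight_diag // mul0r.
  case: forallP => // h'; case: h => j; by rewrite h'.
have -> : [forall j, wt M j == k%:Z] by apply/forallP => j; rewrite h.
case: (Hb) => _ on _ _; have := on M M; rewrite eqxx => <-.
rewrite /hs (eq_bigr (fun p => (b M (p.1, p.2))^* * b M (p.1, p.2))) => [|[] //].
rewrite -(pair_bigA _ (fun x y => (b M (x, y))^* * b M (x, y))) /=.
apply: eq_bigr => v _; rewrite (bigD1 v) //= GT_real big1 ?addr0 // => w wv.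
have [->|/(zero_weight_diag h) e] := eqVneq (b M (v, w)) 0; first by rewrite mulr0.
by rewrite e eqxx in wv.
Qed.

(** Summing the squared diagonals over all patterns counts those of zero weight. *)
Lemma s_lambda_card d (P : Op R m n -> Op R m n) :
  is_dim (@Vcomp R m n k) d -> is_orth_proj (@Vcomp R m n k) P ->
  s_lambda d P = #|[set al : fock m k | occ al i0 == 0%N]|%:R / #|boundary k i0|%:R.
Proof.
move=> /Vcomp_dim -> HP; rewrite /s_lambda mulrC; congr (_ / _).
rewrite -(card_zero_weight i0E ilE i0l card_GT).
transitivity (\sum_v \sum_M b M (v, v) * b M (v, v)).
  apply: eq_bigr => v _; rewrite projector_ketbra // sum_ffunE.
  by apply: eq_bigr => M _; rewrite scale_opE.
rewrite exchange_big /= (eq_bigr _ (fun M _ => sum_diag_sqr M)).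
rewrite -natr_sum -sum1_card [in RHS]big_mkcond /=; congr (_%:R).
by apply: eq_bigr => M _; rewrite inE; case: forallP.
Qed.

End Basis.

(** * Closed form of the dimension, and the filter function *)

Lemma card_boundary (m k : nat) :
  (#|boundary k (ord0 : 'I_m.+2)| * m.+1 = (k.*2 + m.+1) * 'C(k + m, k) ^ 2)%N.
Proof.
pose Z := [set al : fock m.+2 k | occ al ord0 == 0%N].
have cZ : #|Z| = 'C(k + m, m) by rewrite card_fock_ord0 card_fock.
have cA : #|{: fock m.+2 k}| = 'C(k + m.+1, m.+1) by apply: card_fock.
(* Complementary counting: off the boundary both first occupations are positive. *)
have cB : (#|boundary k (ord0 : 'I_m.+2)| + #|setX (~: Z) (~: Z)| =
    #|{: fock m.+2 k}| ^ 2)%N.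
  have -> : setX (~: Z) (~: Z) = ~: boundary k ord0.
    by apply/setP => -[al be]; rewrite !inE /= negb_or.
  by rewrite cardsC card_prod.
have cC := cardsC Z; rewrite cardsX in cB.
(* With z and y the numbers of states with empty and with occupied first mode, this identity becomes
   k z = (m+1) y. *)
have cD := mul_bin_diag (k + m.+1) m.
rewrite -cA addnS /= -cZ -cC in cD; rewrite -cC in cB.
rewrite -(@bin_sub (k + m) k) ?leq_addr // addKn -cZ.
move: cB cD; set x := #|boundary _ _|; set z := #|Z|; set y := #|~: Z|.
move=> cB cD.
have {}cB : (x = z ^ 2 + 2 * (z * y))%N by nia.
have {}cD : (k * z = m.+1 * y)%N by nia.
rewrite cB -muln2; nia.
Qed.

Lemma signz_sqr (R : realType) (z : int) : (-1 : R[i]) ^ z * (-1) ^ z = 1.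
Proof. by rewrite -expfzMl mulrNN mulr1 exp1rz. Qed.

Theorem theoremT5 (R : realType) (m n k : nat) (Hm : (2 <= m)%N) (Hk : (k <= n)%N)
  (v0 : fock m n)
  (d : nat) (Hd : is_dim (@Vcomp R m n k) d)
  (P : Op R m n -> Op R m n) (HP : is_orth_proj (@Vcomp R m n k) P)
  (b : GTpat (@lam m k) -> Op R m n) (Hb : GT_basis b) :
  let s := s_lambda d P in
  [/\ forall (v : fock m n) (g : 'M[R[i]]_m), is_SU g ->
        filter_fn s P v0 v g =
        s^-1 * ((-1) ^ (phiF v0) / (mfact v)%:R) *
        \sum_(M : GTpat (@lam m k)) CG b M v0 v0 *
          \sum_(w : fock m n) ((-1) ^ (phiF w) / (mfact w)%:R) * CG b M w w *
             `|per (gsub g v w)| ^+ 2,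
      s = ((m - 1)%:R / (2 * k + m - 1)%:R) / ('C(k + m - 2, k))%:R &
      forall M : GTpat (@lam m k), (exists j, wt M j != k%:Z) ->
        forall w : fock m n, CG b M w w = 0].
Proof.
move=> s; split=> [v g _||M hM w]; last first.
- by rewrite /CG (nonzero_weight_diag Hb) // mulr0.
- rewrite /s (s_lambda_card Hm Hk Hb Hd HP).
  case: m Hm {v0 d Hd P HP b Hb s} => [|[|m]] // Hm.
  (* From here on [m] counts the modes beyond the first two. *)
  set i0 := Ordinal _; have -> : i0 = ord0 by apply: val_inj.
  have -> : (2 * k + m.+2 - 1 = k.*2 + m.+1)%N by rewrite mul2n addnS subn1.
  have -> : (k + m.+2 - 2 = k + m)%N by rewrite !addnS subn2.
  rewrite subn1 /= card_fock_ord0 card_fock.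
  rewrite -(@bin_sub (k + m) k) ?leq_addr // addKn.
  have := congr1 (fun t => t%:R : R[i]) (card_boundary m k).
  rewrite -(@bin_sub (k + m) k) ?leq_addr // addKn !natrM.
  have Bn0 : 'C(k + m, m)%:R != 0 :> R[i].
    by rewrite pnatr_eq0 -lt0n bin_gt0 leq_addl.
  have m0 : m.+1%:R != 0 :> R[i] by rewrite pnatr_eq0.
  have k0 : (k.*2 + m.+1)%:R != 0 :> R[i] by rewrite pnatr_eq0 addnS.
  move: Bn0 m0 k0; move: ('C(_, _)%:R) (m.+1%:R) ((_ + _)%:R) (#|_|%:R).
  move=> B m1 K bd Bn0 m0 k0 e.
  have -> : bd = K * (B * B) / m1 by rewrite -e mulfK.
  by field; rewrite Bn0 m0 k0.
rewrite /filter_fn -!mulrA; congr (_ * _).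
rewrite (projector_ketbra Hm Hk Hb _ HP) omega_sum sum_ffunE !mulr_sumr.
apply: eq_bigr => M _; rewrite omega_scale scale_opE.
(* Other weights contribute zero; a zero-weight [b M] is diagonal, so only the squared moduli of
   entries of [tau g] appear. *)
have [h|h] := GT_weight_cases M; last first.
  by rewrite /CG (nonzero_weight_diag Hb) // !(mulr0, mul0r).
rewrite (omega_diag _ _ (zero_weight_diag Hb h)) !mulr_sumr.
apply: eq_bigr => w _; rewrite tau_norm /CG.
(* Each phase occurs twice, once explicitly and once inside [CG], and squares to one. *)
have e0 := signz_sqr R (phiF v0); have ew := signz_sqr R (phiF w).
have := mfact_neq0 R v; have := mfact_neq0 R w; move: e0 ew.
move: ((-1) ^ phiF v0) ((-1) ^ phiF w) (_%:R) (_%:R) => p q vf wf e0 ew w0 v1.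
transitivity ((p * p) * (q * q) * (b M (v0, v0) * (b M (w, w) *
   (`|per (gsub g v w)| ^+ 2 / (vf * wf))))); first by rewrite e0 ew !mul1r.
by field; rewrite w0 v1.
Qed.
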